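(* Let $m(n)$ denote the largest possible number of triangles having minimum area formed by $n$ lines in the Euclidean plane. Then for $n\geq 6$, $$\left\lfloor \frac{n^2-n}{6} \right\rfloor \leq m(n)\leq \left\lfloor \frac{n^2-2n}{3}\right\rfloor.$$
   Context: A triangle formed by a set of lines is a triangle whose three sides lie on three distinct lines of the set (a triple of pairwise non-parallel, non-concurrent lines). For an arrangement of $n$ distinct lines in the plane, consider the minimum of the areas of the triangles formed by triples of its lines, and count the triples forming a triangle of that minimum area; $m(n)$ is the maximum of this count over all arrangements of $n$ lines. *)

(* Defs.v *)
From HB Require Import structures.
From mathcomp Require Import all_boot all_order all_algebra.
From mathcomp Require Import boolp classical_sets reals.

Set Implicit Arguments.
Unset Strict Implicit.
Unset Printing Implicit Defensive.

Import Order.TTheory GRing.Theory Num.Theory.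
Local Open Scope classical_set_scope.
Local Open Scope ring_scope.

Definition plane (R : realType) : Type := (R * R)%type.

Definition is_line (R : realType) (l : set (plane R)) : Prop :=
  exists a b c : R, (a, b) <> (0, 0) /\
    l = [set p : plane R | a * p.1 + b * p.2 = c].

(* As usual, a line is parallel to itself. *)
Definition parallel (R : realType) (l1 l2 : set (plane R)) : Prop :=
  l1 = l2 \/ l1 `&` l2 = set0.

Definition forms_triangle (R : realType) (l1 l2 l3 : set (plane R)) : Prop :=
  [/\ ~ parallel l1 l2, ~ parallel l2 l3, ~ parallel l1 l3
    & l1 `&` l2 `&` l3 = set0].

Definition triangle_area (R : realType) (A B C : plane R) : R :=
  `|(B.1 - A.1) * (C.2 - A.2) - (C.1 - A.1) * (B.2 - A.2)| / 2.

Definition is_arrangement (R : realType) (n : nat)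
    (L : 'I_n -> set (plane R)) : Prop :=
  (forall i, is_line (L i)) /\ injective L.

(* The vertices A, B, C are unique, since two non-parallel lines meet in
   exactly one point; T then has exactly three elements. *)
Definition triangle_of_area (R : realType) (n : nat)
    (L : 'I_n -> set (plane R)) (T : {set 'I_n}) (s : R) : Prop :=
  exists i j k : 'I_n,
    [/\ T = [set i; j; k]%SET, forms_triangle (L i) (L j) (L k)
      & exists A B C : plane R,
          [/\ (L j `&` L k) A, (L i `&` L k) B, (L i `&` L j) C
            & s = triangle_area A B C]].

Definition min_area_triangles (R : realType) (n : nat)
    (L : 'I_n -> set (plane R)) : {set {set 'I_n}} :=
  [set T : {set 'I_n} | `[< exists s : R, triangle_of_area L T s /\
     forall (T' : {set 'I_n}) (s' : R), triangle_of_area L T' s' -> s <= s' >]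
  ]%SET.

(* The maximum ranges over all sets S of triples that arise as the set of
   minimum-area triangles of some arrangement of n lines. *)
Definition max_min_area_triangles (R : realType) (n : nat) : nat :=
  (\max_(S : {set {set 'I_n}} |
         `[< exists L : 'I_n -> set (plane R),
               is_arrangement L /\ S = min_area_triangles L >]) #|S|)%N.

(* Main.v *)
Require Import Defs.
From HB Require Import structures.
From mathcomp Require Import all_boot all_order all_algebra.
From mathcomp Require Import boolp classical_sets reals.
From mathcomp Require Import zify ring lra.

(* Upper bound.  A line cutting through a triangle of minimum area would cut a
   smaller triangle off it, so these triangles are cells of the arrangement:
   their sides join consecutive vertices of a line, and a segment carries at
   most one of them on each side.  If m_P lines pass through the vertex P, then
   sum_P m_P (m_P - 1) <= n (n - 1), and the number of triangle sides is at most
   sum_P m_P - n plus the number D of segments with a triangle on both sides.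
   Hence 3 t <= n (n - 2) follows from D <= sum_P m_P (m_P - 2).

   The latter is a discharging argument.  Each doubled segment distributes the
   charge 2 (in half-units) to its endpoints, and P can absorb
   2 m_P (m_P - 2).  A simple vertex (m_P = 2) takes nothing, and two simple
   vertices never bound a doubled segment.  Vertices with m_P >= 4 may take the
   full charge of their at most 2 m_P segments.  At a triple point the six rays
   and the equality of areas leave a single overloaded configuration: the
   centroid of a triangle surrounded by the six small triangles cut out by the
   medians, with some midpoint of a side simple.  It pushes the charge of its
   segments to the corners adjacent to such a midpoint, which have room for it.

   Lower bound.  Take p lines x = a, p lines y = b and r lines x + y = c - 1/2
   with integral a, b, c: every triangle has legs of half-integral length, and
   the minimal ones are those with a + b = c or a + b = c - 1. *)

Set Implicit Arguments.
Unset Strict Implicit.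
Unset Printing Implicit Defensive.

Import Order.TTheory GRing.Theory Num.Theory.
Local Open Scope ring_scope.

(** Here [h], [s], [z] mark the rays that carry a doubled segment, charge 2, charge 0. If some ray
    lacks [h], no missing ray is isolated, so at most four have [h]; as [s] never sits on
    neighbours, the total is at most 4 + 2. If all six have [h], each [s] is offset by the [z] on
    the next ray. *)
Lemma six_ray_count (h s z : nat -> bool) :
  (forall k, h (k + 6)%N = h k) -> (forall k, s (k + 6)%N = s k) ->
  (forall k, s k -> h k) -> (forall k, h k -> h k.+2 -> h k.+1) ->
  (forall k, s k -> s k.+1 -> False) ->
  ((forall k, h k) -> forall k, s k -> z k.+1) -> z 6 = z 0 ->
  (\sum_(k < 6) (h k + s k) <= 6 + \sum_(k < 6) z k)%N.
Proof.
move=> h6 s6 sh hm ss sz z6.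
rewrite !big_ord_recr !big_ord0 /= !add0n.
have hk k : (h k + h k.+2 <= (h k.+1).+1)%N.
  by move: (hm k); case: (h k) (h k.+1) (h k.+2) => [] [] [] // /(_ isT isT).
have sk k : (s k + s k.+1 <= 1)%N.
  by move: (ss k); case: (s k) (s k.+1) => [] [] // /(_ isT isT).
have shk k : (s k <= h k)%N by move: (sh k); case: (s k) (h k) => [] [] // /(_ isT).
case allh : [&& h 0, h 1, h 2, h 3, h 4 & h 5].
  have H k : h k.
    elim/ltn_ind: k; do 6 (case; first by case/and5P: allh => ? ? ? ? /andP[]).
    by move=> k IH; rewrite -[_.+4.+2]/(6 + k)%N addnC h6; apply: IH; do 5 apply: leqW.
  have zk k : (s k <= z k.+1)%N by move: (sz H k); case: (s k) (z k.+1) => [] [] // /(_ isT).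
  move: (zk 0) (zk 1) (zk 2) (zk 3) (zk 4) (zk 5); rewrite z6 !H /=.
  move: (nat_of_bool (s 0)) (nat_of_bool (s 1)) (nat_of_bool (s 2)).
  move: (nat_of_bool (s 3)) (nat_of_bool (s 4)) (nat_of_bool (s 5)).
  move: (nat_of_bool (z 0)) (nat_of_bool (z 1)) (nat_of_bool (z 2)).
  move: (nat_of_bool (z 3)) (nat_of_bool (z 4)) (nat_of_bool (z 5)).
  clear; lia.
move: (hk 0) (hk 1) (hk 2) (hk 3) (hk 4) (hk 5) (sk 0) (sk 1) (sk 2) (sk 3) (sk 4) (sk 5).
move: (shk 0) (shk 1) (shk 2) (shk 3) (shk 4) (shk 5) allh.
rewrite -[X in (_ <= 6 + X)%N]addn0; set zs := (X in (6 + X)%N).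
rewrite (h6 0) (h6 1) (s6 0).
move: (nat_of_bool (s 0)) (nat_of_bool (s 1)) (nat_of_bool (s 2)).
move: (nat_of_bool (s 3)) (nat_of_bool (s 4)) (nat_of_bool (s 5)) zs.
case: (h 0) => /=; case: (h 1) => /=; case: (h 2) => /=;
  case: (h 3) => /=; case: (h 4) => /=; case: (h 5) => //=; clear; lia.
Qed.

Lemma six_count_bound (t n : nat) :
  (6 * t + 2 * n <= 2 * (n * (n - 1)) -> 3 * t <= n * (n - 2))%N.
Proof.
case: n => [|[|n]]; first by rewrite !mul0n muln0; case: t.
  by rewrite subnn !muln0 muln1 addn2.
by rewrite !subSS !subn0; nia.
Qed.

(** * Triangles of minimum area *)

Section Geometry.
Variables (R : realFieldType) (n : nat) (a b c : 'I_n -> R).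

Implicit Types (p q r x y z : R * R) (i j : 'I_n).

(** Twice the signed area. *)
Definition area2 p q r : R :=
  (q.1 - p.1) * (r.2 - p.2) - (r.1 - p.1) * (q.2 - p.2).

Definition lform i p : R := a i * p.1 + b i * p.2 - c i.

Definition on i p : bool := lform i p == 0.

Definition conn p q : bool := [exists i, on i p && on i q].

Definition mult p : nat := #|[set i | on i p]|.

Definition pointAt p q (t : R) : R * R :=
  (p.1 + t * (q.1 - p.1), p.2 + t * (q.2 - p.2)).

(* S is twice the minimum area. *)
Variable S : R.

(** Triangles are ordered triples of points rather than triples of lines; [S > 0] keeps the points
    noncollinear, so the joining lines are distinct. *)
Definition tri p q x : bool :=
  [&& conn p q, conn q x, conn p x & `|area2 p q x| == S].

Hypothesis coef_neq0 : forall i, (a i != 0) || (b i != 0).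
Hypothesis line_uniq : forall i j p q,
  p != q -> on i p -> on i q -> on j p -> on j q -> i = j.
Hypothesis S_gt0 : 0 < S.
Hypothesis S_min : forall p q x,
  conn p q -> conn q x -> conn p x -> area2 p q x != 0 -> S <= `|area2 p q x|.

Lemma connC p q : conn p q = conn q p.
Proof. by apply: eq_existsb => i; rewrite andbC. Qed.

Lemma connP p q : reflect (exists2 i, on i p & on i q) (conn p q).
Proof.
apply: (iffP existsP) => [[i /andP[]]|[i ip iq]]; first by exists i.
by exists i; rewrite ip iq.
Qed.

Lemma conn_on i p q : on i p -> on i q -> conn p q.
Proof. by move=> ip iq; apply/connP; exists i. Qed.

Lemma area2C p q x : area2 q p x = - area2 p q x.
Proof. by rewrite /area2; ring. Qed.

Lemma area2Cr p q x : area2 p x q = - area2 p q x.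
Proof. by rewrite /area2; ring. Qed.

Lemma triC p q x : tri q p x = tri p q x.
Proof.
by rewrite /tri area2C normrN (connC q p) andbA -andbA (andbCA (conn p x)) andbA.
Qed.

Lemma triCr p q x : tri p x q = tri p q x.
Proof.
rewrite /tri area2Cr normrN (connC x q).
by case: (conn p x); case: (conn p q); case: (conn q x).
Qed.

Lemma tri_area_neq0 p q x : tri p q x -> area2 p q x != 0.
Proof. by case/and4P=> _ _ _ /eqP e; rewrite -normr_gt0 e. Qed.

Lemma area2_neq p q x : area2 p q x != 0 -> p != q.
Proof. by apply: contraNneq => ->; apply/eqP; rewrite /area2; ring. Qed.

Lemma tri_area p q x : tri p q x -> area2 p q x = S \/ area2 p q x = - S.
Proof.
case/and4P=> _ _ _ /eqP e; case: (ger0P (area2 p q x)) => h.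
  by left; rewrite -e ger0_norm.
by right; rewrite -e ltr0_norm // opprK.
Qed.

Lemma on_collinear i p q x :
  p != q -> on i p -> on i q -> area2 p q x = 0 -> on i x.
Proof.
rewrite /on /lform /area2 => npq /eqP ip /eqP iq e.
have [e1|n1] := eqVneq (q.1 - p.1) 0.
  have [e2|n2] := eqVneq (q.2 - p.2) 0.
    by case/negP: npq; rewrite -pair_eqE /= /pair_eq /=; apply/andP; split; apply/eqP; lra.
  apply/eqP; apply: (mulfI n2); rewrite mulr0.
  transitivity (a i * (- area2 p q x) +
      (x.2 - p.2) * ((a i * q.1 + b i * q.2 - c i) - (a i * p.1 + b i * p.2 - c i)) +
      (q.2 - p.2) * (a i * p.1 + b i * p.2 - c i)).
    by rewrite /area2; ring.
  by rewrite iq ip /area2 e; ring.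
apply/eqP; apply: (mulfI n1); rewrite mulr0.
transitivity (b i * (area2 p q x) +
    (x.1 - p.1) * ((a i * q.1 + b i * q.2 - c i) - (a i * p.1 + b i * p.2 - c i)) +
    (q.1 - p.1) * (a i * p.1 + b i * p.2 - c i)).
  by rewrite /area2; ring.
by rewrite iq ip /area2 e; ring.
Qed.

Lemma area2_on i p q x : on i p -> on i q -> on i x -> area2 p q x = 0.
Proof.
rewrite /on /lform => /eqP ip /eqP iq /eqP ix.
case/orP: (coef_neq0 i) => nz; apply: (mulfI nz); rewrite mulr0.
  transitivity ((x.2 - p.2) * ((a i * q.1 + b i * q.2 - c i) - (a i * p.1 + b i * p.2 - c i)) -
    (q.2 - p.2) * ((a i * x.1 + b i * x.2 - c i) - (a i * p.1 + b i * p.2 - c i))).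
    by rewrite /area2; ring.
  by rewrite ip iq ix; ring.
transitivity ((q.1 - p.1) * ((a i * x.1 + b i * x.2 - c i) - (a i * p.1 + b i * p.2 - c i)) -
    (x.1 - p.1) * ((a i * q.1 + b i * q.2 - c i) - (a i * p.1 + b i * p.2 - c i))).
  by rewrite /area2; ring.
by rewrite ip iq ix; ring.
Qed.

Lemma lform_pointAt i p q t :
  lform i (pointAt p q t) = (1 - t) * lform i p + t * lform i q.
Proof. by rewrite /lform /pointAt /=; ring. Qed.

Lemma on_pointAt i p q t : on i p -> on i q -> on i (pointAt p q t).
Proof.
by rewrite /on => /eqP ip /eqP iq; rewrite lform_pointAt ip iq !mulr0 addr0.
Qed.

(* The line j separates q from x and meets the side [p, q]: it cuts off at q
   a triangle smaller than the minimum. *)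
Lemma no_cut j p q x t :
  tri p q x -> 0 <= t < 1 -> on j (pointAt p q t) ->
  lform j q != 0 -> lform j q * lform j x <= 0 -> 0 < t \/ lform j x != 0 ->
  False.
Proof.
move=> T /andP[t0 t1] jt jq jqx tx.
case/and4P: (T) => /connP[l lp lq] /connP[m mq mx] _ /eqP eS.
have Tn := tri_area_neq0 T.
(* [s] locates the point where [j] meets the side from [q] to [x]; the piece cut off at [q] has (1 -
   t) * s times the area. *)
set s := lform j q / (lform j q - lform j x).
have [d0 [s0 s1]] : lform j q - lform j x != 0 /\ (0 < s /\ s <= 1).
  have h : 0 < lform j q * (lform j q - lform j x).
    have : 0 < lform j q * lform j q by rewrite -expr2 exprn_even_gt0.
    by nra.
  have dn : lform j q - lform j x != 0 by apply: contraTneq h => ->; rewrite mulr0 ltxx.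
  have dd : 0 < (lform j q - lform j x) ^+ 2 by rewrite exprn_even_gt0.
  split=> //; split.
    have -> : s = lform j q * (lform j q - lform j x) / (lform j q - lform j x) ^+ 2.
      by rewrite /s; field.
    by rewrite divr_gt0.
  rewrite -subr_ge0.
  have -> : 1 - s = (lform j x ^+ 2 - lform j q * lform j x) / (lform j q - lform j x) ^+ 2.
    by rewrite /s; field.
  by rewrite divr_ge0 ?(ltW dd) // subr_ge0 (le_trans jqx) // sqr_ge0.
(* This excludes [t = 0] with [s = 1], where the piece would be the whole triangle. *)
have s1t : s < 1 \/ 0 < t.
  case: tx => [|jx]; [by right|left].
  rewrite lt_neqAle s1 andbT; apply: contraNneq jx => e.
  have : lform j q = s * (lform j q - lform j x) by rewrite /s divfK.
  by rewrite e; lra.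
set y := pointAt q x s.
have jy : on j y.
  rewrite /on lform_pointAt; apply/eqP; rewrite /s; field; exact: d0.
set p' := pointAt p q t.
have e : area2 p' q y = (1 - t) * s * area2 p q x.
  by rewrite /area2 /p' /y /pointAt /=; ring.
have st : 0 < (1 - t) * s by rewrite mulr_gt0 // subr_gt0.
have := S_min (conn_on (on_pointAt t lp lq) lq) (conn_on mq (on_pointAt s mq mx)) (conn_on jt jy).
rewrite e mulf_neq0 ?(gt_eqF st) // => /(_ isT).
rewrite normrM eS gtr0_norm // ler_pMl // => st1.
have : (1 - t) * s < 1 by case: s1t => h; nra.
by rewrite ltNge st1.
Qed.

(** If the edges at [p] had different directions, the one closer to [p q] would have its line cut
    the other triangle. So [p], [x], [y] are collinear, and equal areas give equal points. *)
Lemma tri_side_uniq p q x y :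
  tri p q x -> tri p q y -> area2 p q x = area2 p q y -> x = y.
Proof.
move=> T T' e.
(* the line p y enters the triangle p q x *)
have K z z' : tri p q z -> tri p q z' -> area2 p q z = area2 p q z' ->
    area2 p q z * area2 p z z' < 0 -> False.
  move=> T1 T2 e1 h.
  have n1 := tri_area_neq0 T1.
  case/and4P: (T2) => _ _ /connP[j jp jz'] _.
  have jq : lform j q != 0.
    apply: contraTneq (tri_area_neq0 T2) => jq; rewrite negbK; apply/eqP.
    by apply: area2_on jp _ jz'; rewrite /on jq.
  have e0 : lform j z * area2 p q z' = lform j q * area2 p z z'.
    have f0 w : (lform j w - lform j p) = a j * (w.1 - p.1) + b j * (w.2 - p.2).
      by rewrite /lform; ring.
    move: (f0 z) (f0 q) (f0 z'); move/eqP: (jp) => ->; move/eqP: (jz') => ->.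
    rewrite !subr0 => -> -> h0.
    have -> : (a j * (z.1 - p.1) + b j * (z.2 - p.2)) * area2 p q z' =
      (a j * (q.1 - p.1) + b j * (q.2 - p.2)) * area2 p z z' +
      (a j * (z'.1 - p.1) + b j * (z'.2 - p.2)) * area2 p q z.
      by rewrite /area2; ring.
    by rewrite -h0 mul0r addr0.
  have ez : lform j z = lform j q * (area2 p z z' / area2 p q z).
    by apply: (mulIf n1); rewrite {1}e1 e0; field.
  have q0 : area2 p z z' / area2 p q z < 0.
    have -> : area2 p z z' / area2 p q z = (area2 p q z * area2 p z z') / (area2 p q z) ^+2 by field.
    by rewrite pmulr_llt0 // invr_gt0 exprn_even_gt0.
  have jz0 : lform j z != 0 by rewrite ez mulf_neq0 // lt_eqF.
  apply: (@no_cut j p q z 0 T1) => //; rewrite ?lexx ?ltr01 //.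
  - by have -> : pointAt p q 0 = p by rewrite /pointAt [RHS]surjective_pairing !mul0r !addr0.
  - rewrite ez mulrA -expr2 mulr_ge0_le0 ?sqr_ge0 //; exact: ltW.
  - by right.
have nz := tri_area_neq0 T.
case: (ltgtP (area2 p q x * area2 p x y) 0) => h.
- by case: (K _ _ T T' e h).
- case: (K _ _ T' T (esym e)); rewrite -e.
  by have -> : area2 p y x = - area2 p x y by [rewrite /area2; ring]; rewrite mulrN oppr_lt0.
have h0 : area2 p x y = 0 by move/eqP: h; rewrite mulf_eq0 (negbTE nz) => /eqP.
have e1 : (y.1 - x.1) * area2 p q x = 0.
  have -> : (y.1 - x.1) * area2 p q x = - (q.1 - p.1) * area2 p x y +
      (area2 p q y - area2 p q x) * (x.1 - p.1) by rewrite /area2; ring.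
  by rewrite h0 e subrr mul0r mulr0 addr0.
have e2 : (y.2 - x.2) * area2 p q x = 0.
  have -> : (y.2 - x.2) * area2 p q x = - (q.2 - p.2) * area2 p x y +
      (area2 p q y - area2 p q x) * (x.2 - p.2) by rewrite /area2; ring.
  by rewrite h0 e subrr mul0r mulr0 addr0.
move/eqP: e1; move/eqP: e2; rewrite !mulf_eq0 (negbTE nz) !orbF !subr_eq0 => /eqP e2 /eqP e1.
by rewrite [x]surjective_pairing [y]surjective_pairing e1 e2.
Qed.

(** If two edges on one ray from [p] had different ends, the side opposite [p] of the triangle on
    the shorter edge would lie on a line through an inner point of the longer edge. That line leaves
    the other triangle across one of its remaining sides and cuts off a corner. *)
Lemma tri_edge_uniq p q q' x x' t :
  tri p q x -> tri p q' x' -> 0 < t -> q' = pointAt p q t -> q' = q.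
Proof.
have K w w' y y' u : tri p w y -> tri p w' y' -> 0 < u -> u < 1 ->
    w' = pointAt p w u -> False.
  move=> T T' u0 u1 ew.
  case/and4P: (T') => _ /connP[j jw jy] _ _.
  have jp : lform j p != 0.
    apply: contraTneq (tri_area_neq0 T') => jp; rewrite negbK; apply/eqP.
    by apply: (area2_on (i := j)) => //; rewrite /on jp.
  have jw0 : (1 - u) * lform j p + u * lform j w = 0.
    by apply/eqP; rewrite -lform_pointAt -ew.
  have jwn : lform j w != 0.
    apply: contraNneq jp => e; move: jw0; rewrite e mulr0 addr0 => /eqP.
    by rewrite mulf_eq0 subr_eq0 gt_eqF.
  have pw : lform j p * lform j w < 0.
    rewrite -(pmulr_rlt0 _ u0) mulrCA.
    have -> : u * lform j w = - ((1 - u) * lform j p) by move: jw0; lra.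
    rewrite mulrN oppr_lt0 mulrCA -expr2 mulr_gt0 ?subr_gt0 //.
    by rewrite exprn_even_gt0.
  case: (lerP (lform j w * lform j y) 0) => h.
    apply: (@no_cut j p w y u T); rewrite ?u1 ?(ltW u0) // -?ew //; by left.
  apply: (@no_cut j w p y (1 - u)) => //; first by rewrite triC.
  - by apply/andP; split; lra.
  - have -> // : pointAt w p (1 - u) = w'.
    by rewrite ew /pointAt; congr (_, _); ring.
  - have : 0 < lform j w ^+ 2 by rewrite exprn_even_gt0.
    have : (lform j p * lform j w) * (lform j w * lform j y) < 0 by rewrite nmulr_rlt0.
    have -> : (lform j p * lform j w) * (lform j w * lform j y) =
      lform j w ^+ 2 * (lform j p * lform j y) by ring.
    by move=> h1 h2; rewrite ltW // -(pmulr_rlt0 _ h2).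
  - by left; lra.
move=> T T' t0 e.
case: (ltgtP t 1) => t1.
- by case: (K _ _ _ _ _ T T' t0 t1 e).
- case: (K _ _ _ _ t^-1 T' T); rewrite ?invr_gt0 ?invf_lt1 //.
  have tn : t != 0 by rewrite gt_eqF.
  by rewrite e [LHS]surjective_pairing /pointAt /=; congr (_, _); field.
- by rewrite e t1 /pointAt [RHS]surjective_pairing; congr (_, _); ring.
Qed.

(** Neighbours of [p] in pairwise independent directions lie on different lines through [p].
    Exhibiting too many such directions is the recurrent way to contradict a small multiplicity. *)
Lemma mult_ge p (s : seq (R * R)) :
  all (conn p) s -> pairwise (fun x y => area2 p x y != 0) s ->
  (size s <= mult p)%N.
Proof.
case: s => // x0 s; set s0 := x0 :: s => As Ps.
have [i0 _ _] : exists2 i, on i p & on i x0 by apply/connP; case/andP: As.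
pose f x := odflt i0 [pick i | on i p && on i x].
have fP x : conn p x -> on (f x) p && on (f x) x.
  by rewrite /f; case: pickP => [i //|h] /existsP[i]; rewrite h.
rewrite -(size_map f) /mult cardE; apply: uniq_leq_size.
  rewrite uniq_pairwise pairwise_map.
  apply/(pairwiseP x0) => k l ks ls kl.
  have := pairwiseP x0 Ps k l ks ls kl.
  have /fP/andP[pk kk] := allP As _ (mem_nth x0 ks).
  have /fP/andP[pl ll] := allP As _ (mem_nth x0 ls).
  by apply: contraNneq => /= e; apply/eqP; apply: area2_on pk kk _; rewrite e.
move=> _ /mapP[x xs ->]; rewrite mem_enum inE.
by case/andP: (fP _ (allP As _ xs)).
Qed.

Lemma tri_conn p q x : tri p q x -> [/\ conn p q, conn q x & conn p x].
Proof. by case/and4P. Qed.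

(** * Doubled segments and the triangles they force *)

Lemma frame_eq p q r x y : area2 p q r != 0 ->
  area2 p q x = area2 p q y -> area2 p r x = area2 p r y -> x = y.
Proof.
move=> nz e1 e2; have h1 : (y.1 - x.1) * area2 p q r = 0.
  have -> : (y.1 - x.1) * area2 p q r =
    (area2 p q y - area2 p q x) * (r.1 - p.1) - (area2 p r y - area2 p r x) * (q.1 - p.1).
    by rewrite /area2; ring.
  by rewrite e1 e2 !subrr !mul0r subrr.
have h2 : (y.2 - x.2) * area2 p q r = 0.
  have -> : (y.2 - x.2) * area2 p q r =
    (area2 p q y - area2 p q x) * (r.2 - p.2) - (area2 p r y - area2 p r x) * (q.2 - p.2).
    by rewrite /area2; ring.
  by rewrite e1 e2 !subrr !mul0r subrr.
move/eqP: h1; move/eqP: h2; rewrite !mulf_eq0 (negbTE nz) !orbF !subr_eq0 => /eqP h2 /eqP h1.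
by rewrite [x]surjective_pairing [y]surjective_pairing h1 h2.
Qed.

(** Two distinct third vertices suffice: by [tri_side_uniq] they lie on opposite sides of [p q]. *)
Definition dbl p q : Prop := exists x y, [/\ tri p q x, tri p q y & x <> y].

Lemma dblC p q : dbl p q -> dbl q p.
Proof. by case=> x [y [Tx Ty xy]]; exists x, y; rewrite !(triC p q). Qed.

Lemma dbl_other p q x : dbl p q -> tri p q x ->
  exists2 y, tri p q y & area2 p q y = - area2 p q x.
Proof.
case=> y [z [Ty Tz yz]] Tx.
have yz' : area2 p q y <> area2 p q z by move/(tri_side_uniq Ty Tz).
case: (tri_area Tx) (tri_area Ty) (tri_area Tz) => -> [] ey [] ez;
  try (by case: yz'; rewrite ey ez); rewrite ?opprK;
  by [exists y | exists z].
Qed.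

(* At a simple vertex q both triangles on the edge p q have their third vertex
   on the line q r, so equality of areas makes q a midpoint. *)
Lemma tri_reflect p q r :
  tri p q r -> dbl p q -> mult q = 2 -> tri p q (pointAt r q 2).
Proof.
move=> T Dpq mq; case: (dbl_other Dpq T) => x Tx ex.
suff -> : pointAt r q 2 = x by [].
have Tn := tri_area_neq0 T.
have [cpq cqr cpr] := tri_conn T; have [_ cqx _] := tri_conn Tx.
have h : area2 q r x = 0.
  apply/eqP; apply: contraT => nz.
  have : (size [:: p; r; x] <= mult q)%N.
    apply: mult_ge; rewrite /= ?(connC q p) ?cpq ?cqr ?cqx //= nz !andbT.
    by rewrite !(area2C p q) ex !oppr_eq0 Tn.
  by rewrite mq.
apply: (@frame_eq q p r); first by rewrite area2C oppr_eq0.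
  by rewrite !(area2C p q) ex opprK /area2 /pointAt /=; ring.
by rewrite h /area2 /pointAt /=; ring.
Qed.

Definition comb p q r (u v : R) : R * R :=
  (p.1 + u * (q.1 - p.1) + v * (r.1 - p.1),
   p.2 + u * (q.2 - p.2) + v * (r.2 - p.2)).

(** The lines from [q] to [p], [r] and [v = 2 r - p] are all three lines through [q], so [z] lies on
    [q r] or [q v]. The first is impossible, and on the second the area puts [z] at
    [q - (v - q) / 2]. *)
Lemma tri_next_ray p q r z :
  mult q = 3 -> tri q p r -> conn q (pointAt p r 2) -> tri q p z ->
  area2 q p z = - area2 q p r -> z = comb q p r 2^-1 (-1).
Proof.
move=> mq T cv Tz ez; set v := pointAt p r 2.
have Tn := tri_area_neq0 T.
have [cqp cpr cqr] := tri_conn T; have [_ cpz cqz] := tri_conn Tz.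
have ev1 : area2 q p v = 2 * area2 q p r by rewrite /area2 /v /pointAt /=; ring.
have ev2 : area2 q r v = area2 q p r by rewrite /area2 /v /pointAt /=; ring.
have [h|h] : area2 q r z = 0 \/ area2 q v z = 0.
  case: (eqVneq (area2 q r z) 0); [by left|]; case: (eqVneq (area2 q v z) 0); [by right|].
  move=> n1 n2; have : (size [:: p; r; v; z] <= mult q)%N.
    apply: mult_ge; rewrite /= ?cqp ?cqr ?cqz ?cv //=.
    by rewrite n1 n2 ev1 ev2 ez Tn oppr_eq0 Tn mulf_neq0 // pnatr_eq0.
  by rewrite mq.
- (* the line q v would enter the triangle q p z *)
  have zE : z = comb q p r 0 (-1).
    apply: (@frame_eq q p r) => //; rewrite ?ez ?h /area2 /comb /=; ring.
  case/connP: cv => j jq jv.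
  have jp : lform j p != 0.
    apply: contraTneq Tn => jp; rewrite negbK; apply/eqP.
    have : 2 * area2 q p r = 0 by rewrite -ev1; apply: area2_on jq _ jv; rewrite /on jp.
    by move/eqP; rewrite mulf_eq0 pnatr_eq0 => /eqP.
  have jr : lform j p = 2 * lform j r.
    have := lform_pointAt j p r 2; move/eqP: jv => ->; lra.
  have jz : lform j z = - lform j r.
    have -> : lform j z = 2 * lform j q - lform j r by rewrite zE /comb /lform /=; ring.
    by move/eqP: jq => ->; rewrite mulr0 sub0r.
  have jrn : lform j r != 0 by apply: contraNneq jp => e; rewrite jr e mulr0.
  case: (@no_cut j q p z 0 Tz) => //; rewrite ?lexx ?ltr01 //.
  + by have -> : pointAt q p 0 = q by rewrite /pointAt [RHS]surjective_pairing !mul0r !addr0.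
  + by rewrite jr jz mulrN oppr_le0 -mulrA -expr2 mulr_ge0 ?sqr_ge0.
  + by right; rewrite jz oppr_eq0.
apply: (@frame_eq q p r) => //.
  by rewrite ez /area2 /comb /=; field.
have e0 : area2 q v z = 2 * area2 q r z - area2 q p z.
  by rewrite /area2 /v /pointAt /=; ring.
have -> : area2 q r z = 2^-1 * area2 q p z by move: e0; rewrite h; lra.
by rewrite ez /area2 /comb /=; field.
Qed.

(** Reflecting [r] in [q] and [q] in [r] yields two more neighbours of [p] on the line [q r]: four
    points of a line that misses [p], hence four lines through [p]. *)
Lemma no_adjacent_simple p q r : mult p = 3 -> tri p q r ->
  dbl p q -> dbl p r -> mult q = 2 -> mult r = 2 -> False.
Proof.
move=> mp T Dq Dr mq mr.
have Tx := tri_reflect T Dq mq.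
have Ty : tri p r (pointAt q r 2) by apply: tri_reflect => //; rewrite triCr.
have Tn := tri_area_neq0 T.
set x := pointAt r q 2 in Tx; set y := pointAt q r 2 in Ty.
have [c1 _ c2] := tri_conn T; have [_ _ c3] := tri_conn Tx.
have [_ _ c4] := tri_conn Ty.
have : (size [:: q; r; x; y] <= mult p)%N.
  apply: mult_ge; rewrite /= ?c1 ?c2 ?c3 ?c4 // !andbT.
  have -> : area2 p q x = - 1 * area2 p q r by rewrite /area2 /x /pointAt /=; ring.
  have -> : area2 p q y = 2 * area2 p q r by rewrite /area2 /y /pointAt /=; ring.
  have -> : area2 p r x = - 2 * area2 p q r by rewrite /area2 /x /pointAt /=; ring.
  have -> : area2 p r y = area2 p q r by rewrite /area2 /y /pointAt /=; ring.
  have -> : area2 p x y = 3 * area2 p q r by rewrite /area2 /x /y /pointAt /=; ring.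
  by rewrite !mulf_eq0 (negbTE Tn) !oppr_eq0 ?oner_eq0 !pnatr_eq0.
by rewrite mp.
Qed.

(** Reflection in the simple vertex [r] sends [q] to a neighbour [u] of [p], and [p] to a neighbour
    of [q]. The latter determines the vertex [z] across [p q], and then [q], [r], [u], [z] lie on
    four lines through [p]. *)
Lemma no_doubled_332 p q r : mult p = 3 -> mult q = 3 -> mult r = 2 ->
  tri p q r -> dbl p q -> dbl p r -> dbl q r -> False.
Proof.
move=> mp mq mr T Dpq Dpr Dqr.
have Tn := tri_area_neq0 T.
have T1 : tri q p r by rewrite triC.
have Tu : tri p r (pointAt q r 2) by apply: tri_reflect => //; rewrite triCr.
have Tv : tri q r (pointAt p r 2) by apply: tri_reflect => //; rewrite triCr.
have [z Tz ez] := dbl_other (dblC Dpq) T1.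
have [_ _ cqv] := tri_conn Tv.
have zE := tri_next_ray mq T1 cqv Tz ez.
set u := pointAt q r 2 in Tu.
have [c1 _ c2] := tri_conn T; have [_ _ c3] := tri_conn Tu.
have [_ c4 _] := tri_conn Tz.
have : (size [:: q; r; u; z] <= mult p)%N.
  apply: mult_ge; rewrite /= ?c1 ?c2 ?c3 ?c4 // !andbT.
  have -> : area2 p q u = 2 * area2 p q r by rewrite /area2 /u /pointAt /=; ring.
  have -> : area2 p q z = - 1 * area2 p q r by rewrite zE /area2 /comb /=; field.
  have -> : area2 p r u = area2 p q r by rewrite /area2 /u /pointAt /=; ring.
  have -> : area2 p r z = - 3 / 2 * area2 p q r by rewrite zE /area2 /comb /=; field.
  have -> : area2 p u z = - 2 * area2 p q r by rewrite zE /area2 /u /comb /pointAt /=; field.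
  by rewrite !mulf_eq0 (negbTE Tn) !invr_eq0 !oppr_eq0 ?oner_eq0 !pnatr_eq0.
by rewrite mp.
Qed.

(** * Overloaded triple points *)

Definition full p : Prop := forall q x, tri p q x -> dbl p q.

(* The overloaded triple point p passes its half of the segment p q on to q. *)
Definition push p q : Prop := [/\ mult p = 3, full p, mult q <> 2
  & exists2 z, mult z = 2 & tri p q z].

(** Since [r] is not simple it differs from [z], so the two lie on opposite sides of [p q]. The
    reflection of [q] in [z] is joined to [p], which is the extra line that [tri_next_ray]
    requires. *)
Lemma push_next p q r : push p q -> mult r = 3 -> tri p q r ->
  exists2 z, conn q z & r = comb p q z 2^-1 (-1) /\ area2 p q z = - area2 p q r.
Proof.
move=> [mp Fp mq [z mz Tz]] mr T.
have Tz' : tri p z q by rewrite triCr.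
have Tw := tri_reflect Tz' (Fp _ _ Tz') mz.
have [_ _ cw] := tri_conn Tw; have [_ cz _] := tri_conn Tz.
have e : area2 p q z = - area2 p q r.
  have : area2 p q z <> area2 p q r.
    by move/(tri_side_uniq Tz T) => e; rewrite e mr in mz.
  by case: (tri_area Tz) (tri_area T) => -> [] -> // ; rewrite opprK.
by exists z => //; split=> //; apply: tri_next_ray => //; rewrite e opprK.
Qed.

(** Each pusher determines, by [push_next], the simple vertex on the far side of its segment to [p].
    These two vertices, together with [q] and [r], need four lines through [p]. *)
Lemma no_adjacent_pushers p q r : mult p = 3 -> tri p q r ->
  push q p -> push r p -> False.
Proof.
move=> mp T Pq Pr; have Tn := tri_area_neq0 T.
have [mq _ _ _] := Pq; have [mr _ _ _] := Pr.
have T1 : tri q p r by rewrite triC.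
have T2 : tri r p q by rewrite triC triCr.
have [z cz [rE _]] := push_next Pq mr T1.
have [w cw [qE _]] := push_next Pr mq T2.
have [c1 _ c2] := tri_conn T.
(* The affine relation of [push_next] is solved for the simple vertex, in coordinates with origin
   [p]. *)
have zE : z = comb p q r (3 / 2) (-1).
  by rewrite [LHS]surjective_pairing rE /comb /=; congr (_, _); field.
have wE : w = comb p q r (-1) (3 / 2).
  by rewrite [LHS]surjective_pairing [in RHS]qE /comb /=; congr (_, _); field.
have : (size [:: q; r; z; w] <= mult p)%N.
  apply: mult_ge; rewrite /= ?c1 ?c2 ?cz ?cw // !andbT.
  have -> : area2 p q z = - 1 * area2 p q r by rewrite zE /area2 /comb /=; ring.
  have -> : area2 p q w = 3 / 2 * area2 p q r by rewrite wE /area2 /comb /=; field.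
  have -> : area2 p r z = - 3 / 2 * area2 p q r by rewrite zE /area2 /comb /=; field.
  have -> : area2 p r w = area2 p q r by rewrite wE /area2 /comb /=; field.
  have -> : area2 p z w = 5 / 4 * area2 p q r by rewrite zE wE /area2 /comb /=; field.
  by rewrite !mulf_eq0 (negbTE Tn) !invr_eq0 !oppr_eq0 ?oner_eq0 !pnatr_eq0.
by rewrite mp.
Qed.

(** Both ends are full, so the triangle on [p q] with the simple vertex [z] has all its sides
    doubled, against [no_doubled_332]. *)
Lemma push_asym p q : full p -> push q p -> mult p = 3 -> dbl p q -> False.
Proof.
move=> Fp [mq Fq _ [z mz T]] mp D.
apply: (@no_doubled_332 p q z) => //.
- by rewrite triC.
- by apply: (Fp z q); rewrite triCr triC.
- by apply: (Fq z p); rewrite triCr.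
Qed.

(** * Triple points *)

Definition cross (u v : R * R) : R := u.1 * v.2 - u.2 * v.1.

Definition dirpt p (e : R * R) (t : R) : R * R := (p.1 + t * e.1, p.2 + t * e.2).

(* The six rays of a triple point: u, v, v - u and their opposites. *)
Fixpoint ray (u v : R * R) (k : nat) : R * R :=
  if k is k'.+1 then ray v (v - u) k' else u.

Lemma raySS u v k : ray u v k.+2 = ray u v k.+1 - ray u v k.
Proof. by elim: k u v => [|k IH] u v //; rewrite -[LHS]/(ray v (v - u) k.+2) IH. Qed.

Lemma ray3 u v k : ray u v k.+3 = - ray u v k.
Proof. by rewrite raySS raySS addrAC subrr sub0r. Qed.

Lemma cross_ray u v k : cross (ray u v k) (ray u v k.+1) = cross u v.
Proof.
elim: k u v => [|k IH] u v //.
by rewrite -[LHS]/(cross (ray v (v - u) k) (ray v (v - u) k.+1)) IH /cross /=; ring.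
Qed.

Definition onray p u v k q : Prop := exists2 t, 0 < t & q = dirpt p (ray u v k) t.

(** Rays are indexed by all naturals with period 6, so the neighbours of ray [k] are written [k.+1]
    and [k + 5]. *)
Lemma onray6 p u v k q : onray p u v (k + 6)%N q <-> onray p u v k q.
Proof. by rewrite /onray (_ : (k + 6 = k.+3.+3)%N) ?ray3 ?opprK //; lia. Qed.

Definition frame p u v : Prop :=
  [/\ cross u v != 0,
      forall k, exists2 i, on i p & forall t, on i (dirpt p (ray u v k) t)
    & forall q, conn p q -> q <> p -> exists2 k, (k < 6)%N & onray p u v k q].

(** Three pairwise independent directions satisfy a linear relation with nonzero coefficients.
    Rescaling the first one makes [v - u] a direction of the third line. *)
Lemma frame_exists p : mult p = 3 -> exists u v, frame p u v.
Proof.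
move=> mp.
have : size (enum [set i | on i p]) = 3 by rewrite -cardE.
have := enum_uniq [set i | on i p].
have onE i : on i p = (i \in enum [set i | on i p]) by rewrite mem_enum inE.
case: (enum _) onE => [|i0 [|i1 [|i2 []]]] // onE; rewrite /= !inE => /and3P[].
rewrite negb_or => /andP[n01 n02] n12 _ _.
have p0 : on i0 p by rewrite onE !inE eqxx.
have p1 : on i1 p by rewrite onE !inE eqxx orbT.
have p2 : on i2 p by rewrite onE !inE eqxx !orbT.
pose d i : R * R := (b i, - a i).
have dir i t : on i p -> on i (dirpt p (d i) t).
  rewrite /on => /eqP ip; rewrite -ip /lform /dirpt /d /=; apply/eqP; ring.
have dirV i q : on i p -> on i q -> exists t, q = dirpt p (d i) t.
  rewrite /on /lform => /eqP ip /eqP iq.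
  have e : a i * (q.1 - p.1) + b i * (q.2 - p.2) = 0 by move: ip iq; lra.
  have [b0|bn] := eqVneq (b i) 0.
    have an : a i != 0 by move: (coef_neq0 i); rewrite b0 eqxx orbF.
    move/eqP: e; rewrite b0 mul0r addr0 mulf_eq0 (negbTE an) subr_eq0 => /eqP e.
    exists (- (q.2 - p.2) / a i).
    by rewrite [LHS]surjective_pairing /dirpt /d /= b0 e; congr (_, _); field.
  exists ((q.1 - p.1) / b i).
  rewrite [LHS]surjective_pairing /dirpt /d /=; congr (_, _); first by field.
  apply: (mulfI bn); have -> : b i * q.2 = b i * p.2 - a i * (q.1 - p.1) by move: e; lra.
  by field.
have crossN i j : on i p -> on j p -> i != j -> cross (d i) (d j) != 0.
  move=> ip jp; apply: contraNneq => e.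
  have h : dirpt p (d i) 1 != p.
    rewrite /dirpt /d -pair_eqE /= /pair_eq /= !mul1r negb_and.
    by case/orP: (coef_neq0 i) => h; apply/orP; [right|left];
      apply: contraNneq h => h; apply/eqP; move: h; lra.
  apply/eqP; apply: (line_uniq h) => //; first exact: dir.
  rewrite /on /lform /dirpt /=; move: e jp; rewrite /cross /on /lform /d /= => e /eqP jp.
  by apply/eqP; move: e jp; lra.
have c02 := crossN _ _ p0 p2 n02; have c01 := crossN _ _ p0 p1 n01.
have c12 := crossN _ _ p1 p2 n12.
(* Cramer's rule for [d i1] = [al] * [d i0] - [be] * [d i2]. *)
pose al := cross (d i1) (d i2) / cross (d i0) (d i2).
pose be := - cross (d i0) (d i1) / cross (d i0) (d i2).
have aln : al != 0 by rewrite mulf_neq0 ?invr_eq0.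
have ben : be != 0 by rewrite mulf_neq0 ?invr_eq0 ?oppr_eq0.
pose u := (al * (d i0).1, al * (d i0).2); pose v := d i1.
have e2 : v - u = (- be * (d i2).1, - be * (d i2).2).
  by rewrite [LHS]surjective_pairing /v /u /al /be /=; congr (_, _);
    move: c02; rewrite /cross /d /= => ?; field.
have scal i s t : dirpt p (s * (d i).1, s * (d i).2) t = dirpt p (d i) (t * s).
  by rewrite /dirpt /=; congr (_, _); ring.
have opp e t : dirpt p (- e) t = dirpt p e (- t).
  by rewrite /dirpt /=; congr (_, _); ring.
exists u, v; split.
- have -> : cross u v = al * cross (d i0) (d i1) by rewrite /cross /u /v /=; ring.
  by rewrite mulf_neq0.
- elim/ltn_ind; case=> [_|[_|[_|k IH]]].
  + by exists i0 => // t; rewrite /= scal; apply: dir.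
  + by exists i1 => // t; apply: dir.
  + by exists i2 => // t; rewrite /= e2 scal; apply: dir.
  + have [i ip h] : exists2 i, on i p & forall t, on i (dirpt p (ray u v k) t).
      by apply: IH; do 2 apply: leqW.
    by exists i => // t; rewrite ray3 opp.
move=> q /connP[i ip iq] qp.
have fin k s : s != 0 -> (k < 3)%N ->
    (forall t, dirpt p (ray u v k) t = dirpt p (d i) (t * s)) ->
    exists2 l, (l < 6)%N & onray p u v l q.
  move=> sn k3 h; have [t qE] := dirV _ _ ip iq.
  have tn : t != 0.
    apply/eqP => t0; apply: qp; rewrite qE t0 [RHS]surjective_pairing /dirpt.
    by rewrite !mul0r !addr0.
  have qE' : q = dirpt p (ray u v k) (t / s) by rewrite h divfK.
  case: (ltgtP (t / s) 0) => h0.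
  - exists k.+3 => //.
    by exists (- (t / s)); rewrite ?oppr_gt0 // ray3 opp opprK.
  - by exists k; [exact: ltn_trans k3 _ | exists (t / s)].
  - by move/eqP: h0; rewrite mulf_eq0 invr_eq0 (negbTE sn) (negbTE tn).
move: (ip); rewrite onE !inE => /or3P[] /eqP e; rewrite e in fin.
- by apply: (fin 0%N al) => // t; rewrite -scal.
- by apply: (fin 1%N 1) => // [|t]; rewrite ?oner_eq0 // mulr1.
- by apply: (fin 2%N (- be)) => // [|t]; rewrite ?oppr_eq0 //= e2 scal.
Qed.

Section TriplePoint.
Variables (p u v : R * R).
Hypotheses (mp : mult p = 3) (Fr : frame p u v).

Let onr := onray p u v.

Lemma tri_neq q x : tri p q x -> q <> p.
Proof. by move/tri_area_neq0/area2_neq/eqP => h e; apply: h. Qed.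

Lemma onray_cover k q : conn p q -> q <> p -> exists2 m, (m < 6)%N & onr (k + m)%N q.
Proof.
case: Fr => _ _ cov cq nq; have [l l6 ol] := cov _ cq nq.
have mul (h m : nat) : onr h q -> onr (h + m * 6)%N q.
  by move=> oh; elim: m => [|m IH]; rewrite ?addn0 // mulSn addnCA addnC; apply/onray6.
have mulV (h m : nat) : onr (h + m * 6)%N q -> onr h q.
  elim: m => [|m IH]; rewrite ?addn0 // mulSn addnCA addnC => /onray6; exact: IH.
(* [5 * k] plays the role of -k modulo 6. *)
exists ((l + 5 * k) %% 6)%N; first by rewrite ltn_mod.
apply: (mulV _ ((l + 5 * k) %/ 6)%N).
have -> : (k + (l + 5 * k) %% 6 + (l + 5 * k) %/ 6 * 6 = l + k * 6)%N.
  by rewrite -addnA [X in (k + X)%N]addnC -divn_eq addnCA -mulSn mulnC.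
exact: mul.
Qed.

Lemma onray_area k q x : onr k q -> onr k.+1 x ->
  exists2 t, 0 < t & area2 p q x = t * cross u v.
Proof.
move=> [s s0 ->] [t t0 ->]; exists (s * t); first exact: mulr_gt0.
rewrite -(cross_ray u v k) /area2 /cross /dirpt /=; ring.
Qed.

(** On ray [k] or its opposite [x] would be collinear with [p] and [q]. Two rays away from [k], the
    line along the ray in between passes through [p] and separates [x] from [q], which [no_cut]
    forbids. *)
Lemma tri_sector k q x : tri p q x -> onr k q -> onr k.+1 x \/ onr (k + 5)%N x.
Proof.
move=> T [s s0 qE].
have [_ _ cpx] := tri_conn T.
have xp : x <> p by apply: (@tri_neq x q); rewrite triCr.
have Tn := tri_area_neq0 T.
pose g j l := a j * (ray u v l).1 + b j * (ray u v l).2.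
have lin j t l : on j p -> lform j (dirpt p (ray u v l) t) = t * g j l.
  by rewrite /on => /eqP jp; rewrite -[RHS]addr0 -jp /g /lform /dirpt /=; ring.
have gSS j l : g j l.+2 = g j l.+1 - g j l by rewrite /g raySS /=; ring.
have [m m6 [t t0 xE]] := onray_cover k cpx xp.
have cut l : (forall j, g j l = 0 -> g j (k + m)%N = - g j k) -> False.
  move=> h; case: Fr => _ /(_ l) [j jp jr] _.
  have jl : g j l = 0 by have := lin j 1 l jp; move/eqP: (jr 1) => ->; rewrite mul1r.
  have e : lform j x = - (t / s) * lform j q.
    by rewrite xE qE !lin // h //; field; rewrite gt_eqF.
  have ts : 0 < t / s by rewrite divr_gt0.
  have jq : lform j q != 0.
    apply: contraTneq Tn => jq; rewrite negbK; apply/eqP; apply: (area2_on jp).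
      by rewrite /on jq.
    by rewrite /on e jq mulr0.
  apply: (@no_cut j p q x 0 T) => //; rewrite ?lexx ?ltr01 //.
  - by have -> : pointAt p q 0 = p by rewrite /pointAt [RHS]surjective_pairing !mul0r !addr0.
  - by rewrite e mulNr mulrN oppr_le0 mulrCA -expr2 mulr_ge0 ?sqr_ge0 // ltW.
  - by right; rewrite e mulf_neq0 // oppr_eq0 gt_eqF.
case: m m6 xE cut => [|[|[|[|[|[|m]]]]]] // _;
  rewrite ?addn0 ?addn1 ?addn2 ?addn3 ?addn4 => xE cut.
- by case/negP: Tn; rewrite qE xE /area2 /dirpt /=; apply/eqP; ring.
- by left; exists t.
- by case: (cut k.+1) => j e; rewrite gSS e sub0r.
- by case/negP: Tn; rewrite qE xE ray3 /area2 /dirpt /=; apply/eqP; ring.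
(* The ray in between is [k + 5], opposite to [k.+2] and hence on the same line. *)
- by case: (cut k.+2) => j e; rewrite !gSS; rewrite gSS in e; move: e; lra.
- by right; exists t.
Qed.

Lemma onray_uniq k q q' x x' :
  tri p q x -> tri p q' x' -> onr k q -> onr k q' -> q' = q.
Proof.
move=> T T' [s s0 qE] [t t0 qE'].
apply: (@tri_edge_uniq p q q' x x' (t / s)) => //; first exact: divr_gt0.
have sn : s != 0 by rewrite gt_eqF.
by rewrite qE qE' /pointAt /dirpt /=; congr (_, _); field.
Qed.

Lemma dbl_sectors k q : dbl p q -> onr k q ->
  exists x y, [/\ tri p q x, tri p q y, onr k.+1 x & onr (k + 5)%N y].
Proof.
move=> [x [y [Tx Ty xy]]] ok.
have fwd w w' : tri p q w -> tri p q w' -> onr k.+1 w -> onr k.+1 w' -> w = w'.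
  by move=> T T' o o'; apply: (@onray_uniq k.+1 w' w q q) => //; rewrite triCr.
have bwd w w' : tri p q w -> tri p q w' -> onr (k + 5)%N w -> onr (k + 5)%N w' -> w = w'.
  by move=> T T' o o'; apply: (@onray_uniq (k + 5)%N w' w q q) => //; rewrite triCr.
case: (tri_sector Tx ok) (tri_sector Ty ok) => ox [] oy.
- by case: xy; apply: fwd.
- by exists x, y.
- by exists y, x.
- by case: xy; apply: bwd.
Qed.

(** The neighbours that leave the whole charge of their doubled segment to [p]. *)
Definition special q : Prop := mult q = 2 \/ push q p.

Definition ray_dbl k : Prop := exists2 q, dbl p q & onr k q.
Definition ray_special k : Prop := exists q, [/\ dbl p q, onr k q & special q].
Definition ray_push k : Prop :=
  exists q, [/\ dbl p q, onr k q, ~ special q & push p q].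

(** The outer segments each have a triangle reaching ray [k.+1]. By [onray_uniq] both end there at
    the same vertex, so the middle segment has a triangle on either side. *)
Lemma ray_dbl_mid k : ray_dbl k -> ray_dbl k.+2 -> ray_dbl k.+1.
Proof.
move=> [q Dq oq] [r Dr or].
have [x [_ [Tx _ ox _]]] := dbl_sectors Dq oq.
have [_ [y [_ Ty _ oy]]] := dbl_sectors Dr or.
have {}oy : onr k.+1 y by apply/onray6; move: oy; rewrite addSnnS -addSnnS.
have exy : x = y.
  apply: (@onray_uniq k.+1 y x r q) => //; by rewrite triCr.
exists x => //; rewrite -exy in Ty.
have [s s0 es] := onray_area oq ox; have [t t0 et] := onray_area ox or.
exists q, r; split; rewrite 1?triCr // => e; rewrite e in es.
have [cn _ _] := Fr.
have : (s + t) * cross u v = 0 by rewrite mulrDl -es -et (area2Cr p r x) subrr.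
by move/eqP; rewrite mulf_eq0 (negbTE cn) orbF gt_eqF // addr_gt0.
Qed.

(** The two vertices span a triangle with [p], and every combination of simple vertices and pushers
    is excluded. In the mixed cases the pusher is full, which doubles the third side. *)
Lemma no_adjacent_special k : ray_special k -> ray_special k.+1 -> False.
Proof.
move=> [q [Dq oq Sq]] [r [Dr or Sr]].
have [x [_ [Tx _ ox _]]] := dbl_sectors Dq oq.
have [w [_ [Tw _ _ _]]] := dbl_sectors Dr or.
have {x Tx ox} T : tri p q r.
  by rewrite (@onray_uniq k.+1 x r q w) // triCr.
case: Sq Sr => [mq|Pq] [mr|Pr].
- exact: no_adjacent_simple T Dq Dr mq mr.
- case: (Pr) => mr Fr' _ _.
  apply: (@no_doubled_332 p r q) => //; first by rewrite triCr.
  by apply: (Fr' q p); rewrite triC triCr triC.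
- case: (Pq) => mq Fq _ _.
  apply: (@no_doubled_332 p q r) => //.
  by apply: (Fq r p); rewrite triCr triC.
- exact: no_adjacent_pushers T Pq Pr.
Qed.

Lemma ray_dbl_full : (forall k, ray_dbl k) -> full p.
Proof.
move=> all q x T; have [c1 _ _] := tri_conn T.
have [k _ ok] := onray_cover 0 c1 (tri_neq T).
have [q' Dq' oq'] := all (0 + k)%N.
have [w [_ [Tw _ _ _]]] := dbl_sectors Dq' oq'.
by rewrite (onray_uniq Tw T oq' ok).
Qed.

(** With six doubled rays [p] is full, so by [push_asym] nobody pushes to [p] and the special vertex
    is simple. Its neighbour on the next ray cannot be simple as well, and [p] pushes to it. *)
Lemma special_push k : (forall k, ray_dbl k) -> ray_special k -> ray_push k.+1.
Proof.
move=> all [q [Dq oq Sq]]; have Fp := ray_dbl_full all.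
have mq : mult q = 2 by case: Sq => // Pq; case: (push_asym Fp Pq mp Dq).
have [x [_ [Tx _ ox _]]] := dbl_sectors Dq oq.
have Tx' : tri p x q by rewrite triCr.
have Dx := Fp _ _ Tx'.
have mx : mult x <> 2 by move=> mx; apply: no_adjacent_simple Tx Dq Dx mq mx.
exists x; split=> //; last by split=> //; exists q.
by case=> // Px; apply: push_asym Fp Px mp Dx.
Qed.

End TriplePoint.

(** * Counting *)

Section Counting.
Variables (V : finType) (pt : V -> R * R).
Hypothesis pt_inj : injective pt.
Hypothesis mult_pt : forall P, (2 <= mult (pt P))%N.
Hypothesis pt_complete :
  forall i j p, i != j -> on i p -> on j p -> exists P, pt P = p.

Implicit Types P Q X : V.

Lemma tri_vertex p q x : tri p q x -> exists P, pt P = p.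
Proof.
move=> T; case/and4P: (T) => /connP[i ip iq] _ /connP[j jp jx] _.
apply: (pt_complete _ ip jp); apply: contraTneq (tri_area_neq0 T) => e.
by rewrite negbK; apply/eqP; apply: area2_on ip iq _; rewrite e.
Qed.

Definition edge p q : Prop := exists x, tri p q x.

Lemma dbl_edge p q : dbl p q -> edge p q.
Proof. by case=> x [y [T _ _]]; exists x. Qed.

(** The reflections of the third vertex in [p] and in [q] both give the triangle on the other side,
    so they coincide, and then [p = q]. *)
Lemma dbl_neq_simple p q : dbl p q -> mult p = 2 -> mult q = 2 -> False.
Proof.
move=> D mp mq; case: (D) => x [_ [T _ _]].
have Tr := tri_reflect T D mq.
have := tri_reflect (p := q) (q := p) (r := x).
rewrite triC => /(_ T (dblC D) mp); rewrite triC => Tr'.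
have e : area2 p q (pointAt x q 2) = area2 p q (pointAt x p 2).
  by rewrite /area2 /pointAt /=; ring.
have := tri_side_uniq Tr Tr' e => - [e1 e2].
move/tri_area_neq0/area2_neq/negP: T; apply.
by rewrite -pair_eqE /= /pair_eq /=; apply/andP; split; apply/eqP; move: e1 e2; lra.
Qed.

(* The share of p in the charge of the doubled segment p q, in half-units. *)
Definition charge p q : nat :=
  if mult p == 2 then 0%N else
  if `[< special p q >] then 2 else if `[< push p q >] then 0%N else 1%N.

Lemma charge_le2 p q : (charge p q <= 2)%N.
Proof. by rewrite /charge; case: ifP => // _; case: ifP => // _; case: ifP. Qed.

(** An end gets charge 0 only if it is simple or pushes, and either makes it special for the other
    end, which then takes 2. *)
Lemma charge_sum p q : dbl p q -> (2 <= charge p q + charge q p)%N.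
Proof.
move=> D; rewrite /charge.
case: (eqVneq (mult p) 2) (eqVneq (mult q) 2) => [mp|mp] [mq|mq].
- by case: (dbl_neq_simple D mp mq).
- by rewrite asboolT //; left.
- by rewrite asboolT //; left.
case: (asboolP (push p q)) => [Ppq|npq].
  by rewrite (asboolT (P := special q p)) ?leq_addl //; right.
case: (asboolP (push q p)) => [Pqp|nqp].
  by rewrite (asboolT (P := special p q)) ?leq_addr //; right.
by do 2 case: ifP.
Qed.

Lemma charge_triple p : mult p = 3 ->
  (\sum_(Q | `[< dbl p (pt Q) >]) charge p (pt Q) <= 6)%N.
Proof.
move=> mp; have [u [v Fr]] := frame_exists mp.
pose h k := `[< ray_dbl p u v k >]; pose s k := `[< ray_special p u v k >].
pose z k := `[< ray_push p u v k >].
have r6 k : onray p u v (k + 6)%N = onray p u v k.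
  by apply/funext => q; apply/propext; exact: onray6.
have h6 k : h (k + 6)%N = h k by rewrite /h /ray_dbl r6.
have s6 k : s (k + 6)%N = s k by rewrite /s /ray_special r6.
have z6 : z 6 = z 0 by rewrite /z /ray_push -(r6 0%N).
have cnt : (\sum_(k < 6) (h k + s k) <= 6 + \sum_(k < 6) z k)%N.
  apply: six_ray_count => //.
  - by move=> k /asboolP[q [Dq oq _]]; apply/asboolP; exists q.
  - by move=> k /asboolP h1 /asboolP h2; apply/asboolP; apply: ray_dbl_mid.
  - by move=> k /asboolP h1 /asboolP h2; apply: no_adjacent_special h1 h2.
  - move=> all k /asboolP sk; apply/asboolP; apply: special_push => // l.
    exact/asboolP/all.
(* Ray [k] contributes [h k + s k - z k]; the [z] terms go to the left to avoid truncated
   subtraction. *)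
rewrite -(leq_add2r (\sum_(k < 6) z k)); apply: leq_trans cnt.
(* [W k] is the charge on ray [k], where at most one doubled segment starts. *)
pose W (k : nat) := (\sum_(Q | `[< dbl p (pt Q) >])
   (`[< onray p u v k (pt Q) >] * charge p (pt Q)))%N.
apply: (@leq_trans (\sum_(k < 6) W k + \sum_(k < 6) z k)).
  rewrite leq_add2r /W exchange_big /=; apply: leq_sum => Q /asboolP D.
  have [x T] := dbl_edge D.
  have [c1 _ _] := tri_conn T.
  have [m m6 om] := onray_cover Fr 0 c1 (tri_neq T).
  rewrite (bigD1 (Ordinal m6)) //= asboolT ?mul1n ?leq_addr //.
rewrite -big_split /=; apply: leq_sum => k _.
case: (pselect (exists Q, dbl p (pt Q) /\ onray p u v k (pt Q))) => [[Q [D o]]|no].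
  have [x T] := dbl_edge D.
  have uniqQ q : dbl p q -> onray p u v k q -> q = pt Q.
    by case/dbl_edge=> y Ty oq; apply: (onray_uniq T Ty o oq).
  have -> : W k = charge p (pt Q).
    rewrite /W (bigD1 Q) /=; last exact/asboolP.
    rewrite asboolT // mul1n big1 ?addn0 // => P /andP[/asboolP DP nPQ].
    rewrite asboolF // => oP; case/negP: nPQ; apply/eqP/pt_inj.
    exact: uniqQ.
  have -> : h k = true by apply/asboolP; exists (pt Q).
  have zP : z k -> ~ special p (pt Q) /\ push p (pt Q).
    by case/asboolP=> q [Dq oq ns Pq]; rewrite -(uniqQ q).
  rewrite /charge mp /=.
  case: (asboolP (special p (pt Q))) => sp.
    have -> : s k = true by apply/asboolP; exists (pt Q).
    by case: (z k) zP => // /(_ isT) [].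
  case: (asboolP (push p (pt Q))) => pu; first by case: (z k); rewrite ?leq_addr.
  by case: (z k) zP => [/(_ isT) []|]; rewrite ?leq_addr.
have -> : W k = 0%N.
  rewrite /W big1 // => P /asboolP DP; rewrite asboolF // => oP.
  by apply: no; exists P.
suff -> : z k = false by [].
apply: asboolF => -[q [Dq oq _ _]]; case: (dbl_edge Dq) => x.
by rewrite triC => /tri_vertex [Q eQ]; apply: no; exists Q; rewrite eQ.
Qed.

(** A coordinate along line [i]: the scalar product with the direction (b i, - a i). *)
Definition kappa i p : R := b i * p.1 - a i * p.2.

Lemma kappa_inj i p q : on i p -> on i q -> kappa i p = kappa i q -> p = q.
Proof.
rewrite /on /lform /kappa => /eqP ip /eqP iq e.
have N : 0 < a i ^+ 2 + b i ^+ 2.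
  case/orP: (coef_neq0 i) => h; [apply: ltr_pwDl|apply: ltr_wpDl];
    by rewrite ?sqr_ge0 ?exprn_even_gt0.
have Nn : a i ^+ 2 + b i ^+ 2 != 0 by rewrite gt_eqF.
have e1 : a i * (p.1 - q.1) + b i * (p.2 - q.2) = 0 by move: ip iq; lra.
have e2 : b i * (p.1 - q.1) - a i * (p.2 - q.2) = 0 by move: e; lra.
have h1 : (a i ^+ 2 + b i ^+ 2) * (p.1 - q.1) = 0.
  transitivity (a i * (a i * (p.1 - q.1) + b i * (p.2 - q.2)) +
    b i * (b i * (p.1 - q.1) - a i * (p.2 - q.2))); first by ring.
  by rewrite e1 e2 !mulr0 addr0.
have h2 : (a i ^+ 2 + b i ^+ 2) * (p.2 - q.2) = 0.
  transitivity (b i * (a i * (p.1 - q.1) + b i * (p.2 - q.2)) -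
    a i * (b i * (p.1 - q.1) - a i * (p.2 - q.2))); first by ring.
  by rewrite e1 e2 !mulr0 subrr.
move/eqP: h1; move/eqP: h2; rewrite !mulf_eq0 (negbTE Nn) /= !subr_eq0.
by move=> /eqP h2 /eqP h1; rewrite [p]surjective_pairing [q]surjective_pairing h1 h2.
Qed.

Lemma edge_side_uniq i p q q' : on i p -> on i q -> on i q' ->
  edge p q -> edge p q' ->
  0 < (kappa i q - kappa i p) * (kappa i q' - kappa i p) -> q' = q.
Proof.
move=> ip iq iq' [x T] [x' T'] h.
have dn : kappa i q - kappa i p != 0 by apply: contraTneq h => ->; rewrite mul0r ltxx.
pose t := (kappa i q' - kappa i p) / (kappa i q - kappa i p).
apply: (tri_edge_uniq T T' (t := t)).
  have -> : t = (kappa i q - kappa i p) * (kappa i q' - kappa i p) / (kappa i q - kappa i p) ^+ 2.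
    by rewrite /t; field.
  by rewrite divr_gt0 // exprn_even_gt0.
apply: (kappa_inj iq' (on_pointAt t ip iq)).
have -> : kappa i (pointAt p q t) = kappa i p + t * (kappa i q - kappa i p).
  by rewrite /kappa /pointAt /=; ring.
by rewrite /t divfK // addrCA subrr addr0.
Qed.

(** * Counting edges along lines, as ordered pairs of vertices *)

Definition edgeb P Q : bool := `[< edge (pt P) (pt Q) >].
Definition dblb P Q : bool := `[< dbl (pt P) (pt Q) >].
Definition nbrs (lt : rel R) i P : {set V} :=
  [set Q | [&& on i (pt Q), edgeb P Q & lt (kappa i (pt Q)) (kappa i (pt P))]].

Lemma nbrs_lt_le1 i P : on i (pt P) -> (#|nbrs <%R i P| <= 1)%N.
Proof.
move=> iP; apply/card_le1_eqP => Q Q'; rewrite !inE.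
move=> /and3P[iQ /asboolP eQ kQ] /and3P[iQ' /asboolP eQ' kQ'].
apply: pt_inj; apply: (edge_side_uniq iP) => //.
by rewrite nmulr_lgt0 ?subr_lt0.
Qed.

Lemma nbrs_gt_le1 i P : on i (pt P) -> (#|nbrs >%R i P| <= 1)%N.
Proof.
move=> iP; apply/card_le1_eqP => Q Q'; rewrite !inE.
move=> /and3P[iQ /asboolP eQ kQ] /and3P[iQ' /asboolP eQ' kQ'].
apply: pt_inj; apply: (edge_side_uniq iP) => //.
by rewrite pmulr_lgt0 ?subr_gt0.
Qed.

Lemma edge_nbrs i P Q : on i (pt P) -> on i (pt Q) -> edgeb P Q ->
  (1 <= (Q \in nbrs <%R i P) + (Q \in nbrs >%R i P))%N.
Proof.
move=> iP iQ e; rewrite !inE iQ e /=.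
case: (ltgtP (kappa i (pt Q)) (kappa i (pt P))) => // /(kappa_inj iQ iP) h.
case/asboolP: e => x /tri_area_neq0/area2_neq; by rewrite h eqxx.
Qed.

Lemma edges_at i P : on i (pt P) ->
  (\sum_(Q | on i (pt Q)) edgeb P Q <= #|nbrs <%R i P| + #|nbrs >%R i P|)%N.
Proof.
move=> iP; rewrite -!sum1_card [X in (_ <= X + _)%N]big_mkcond [X in (_ <= _ + X)%N]big_mkcond.
rewrite -big_split [X in (X <= _)%N]big_mkcond /=; apply: leq_sum => Q _.
case: ifP => // iQ; case: (boolP (edgeb P Q)) => // e.
by have := edge_nbrs iP iQ e; do 2 case: (Q \in _).
Qed.

Lemma edgeb_on P Q : edgeb P Q -> exists2 i, on i (pt P) & on i (pt Q).
Proof. by case/asboolP=> x /tri_conn[/connP]. Qed.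

Lemma dbl_degree P : (\sum_Q dblb P Q <= 2 * mult (pt P))%N.
Proof.
apply: (@leq_trans (\sum_(i in [set i | on i (pt P)])
    \sum_(Q | on i (pt Q)) edgeb P Q)).
  under [X in (_ <= X)%N]eq_bigr do rewrite big_mkcond.
  rewrite exchange_big /=; apply: leq_sum => Q _.
  case: (boolP (dblb P Q)) => // /asboolP /dbl_edge /asboolP e.
  have [i iP iQ] := edgeb_on e.
  by rewrite (bigD1 i) ?inE //= iQ [edgeb _ _]e.
rewrite mulnC /mult -sum_nat_const; apply: leq_sum => i; rewrite inE => iP.
by apply: leq_trans (edges_at iP) _; apply: (leq_add (nbrs_lt_le1 iP) (nbrs_gt_le1 iP)).
Qed.

Lemma charge_total P :
  (\sum_(Q | dblb P Q) charge (pt P) (pt Q) <= 2 * (mult (pt P) * (mult (pt P) - 2)))%N.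
Proof.
have := mult_pt P; case: (ltngtP 3 (mult (pt P))) => [m4 _|m2 m2'|m3 _].
- apply: (@leq_trans (2 * \sum_Q dblb P Q)).
    rewrite big_distrr big_mkcond /=; apply: leq_sum => Q _.
    by case: (dblb P Q); rewrite ?charge_le2.
  apply: (@leq_trans (2 * (2 * mult (pt P)))); first by rewrite leq_mul2l dbl_degree.
  case: (mult (pt P)) m4 => [|[|[|[|m]]]] // _.
  by rewrite leq_mul2l mulnC leq_mul2l !subSS subn0.
- have m : mult (pt P) = 2 by apply/eqP; rewrite eqn_leq m2' -ltnS m2.
  by rewrite big1 // => Q _; rewrite /charge m.
- by rewrite -m3; apply: charge_triple.
Qed.

Lemma dbl_sum :
  (\sum_P \sum_Q dblb P Q <= \sum_P 2 * (mult (pt P) * (mult (pt P) - 2)))%N.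
Proof.
apply: (@leq_trans (\sum_P \sum_(Q | dblb P Q) charge (pt P) (pt Q))); last first.
  by apply: leq_sum => P _; apply: charge_total.
(* Doubling symmetrizes the sum: each ordered pair then carries the charges of both ends, at least
   2. *)
rewrite -(leq_pmul2l (isT : 0 < 2)%N).
have -> : (2 * \sum_P \sum_(Q | dblb P Q) charge (pt P) (pt Q) =
    \sum_P \sum_Q (dblb P Q * (charge (pt P) (pt Q) + charge (pt Q) (pt P))))%N.
  have -> : (\sum_P \sum_(Q | dblb P Q) charge (pt P) (pt Q) =
      \sum_P \sum_Q (dblb P Q * charge (pt P) (pt Q)))%N.
    apply: eq_bigr => P _; rewrite big_mkcond; apply: eq_bigr => Q _.
    by case: (dblb P Q); rewrite ?mul1n ?mul0n.
  rewrite mul2n -addnn [X in (_ + X)%N]exchange_big -big_split /=.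
  apply: eq_bigr => P _; rewrite -big_split /=; apply: eq_bigr => Q _.
  have -> : dblb Q P = dblb P Q by apply/asboolP/asboolP; apply: dblC.
  by rewrite mulnDr.
rewrite big_distrr; apply: leq_sum => P _; rewrite big_distrr; apply: leq_sum => Q _.
by case: (boolP (dblb P Q)) => // /asboolP D; rewrite mul1n; apply: charge_sum.
Qed.

Lemma third_vertices P Q :
  (\sum_X tri (pt P) (pt Q) (pt X) <= edgeb P Q + dblb P Q)%N.
Proof.
pose A := [set X | tri (pt P) (pt Q) (pt X)].
have -> : (\sum_X tri (pt P) (pt Q) (pt X) = #|A|)%N.
  by rewrite -sum1_card [RHS]big_mkcond /=; apply: eq_bigr => X _; rewrite inE; case: tri.
have [A1|A1] := leqP #|A| 1.
  case: (set_0Vmem A) => [->|[X]]; first by rewrite cards0.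
  rewrite inE => T; apply: leq_trans A1 _.
  by have -> : edgeb P Q by [apply/asboolP; exists (pt X)]; rewrite leq_addr.
have [X [Y [XA YA XY]]] := card_gt1P A1.
rewrite !inE in XA YA.
have -> : edgeb P Q by apply/asboolP; exists (pt X).
have -> : dblb P Q.
  by apply/asboolP; exists (pt X), (pt Y); split=> // /pt_inj/eqP; apply/negP.
(* The sign of the area maps the third vertices injectively to [bool]. *)
rewrite -[(_ + _)%N]/2%N -card_bool.
apply: (@leq_card_in _ _ (fun X => area2 (pt P) (pt Q) (pt X) == S)).
move=> Z W; rewrite !inE => TZ TW e; apply: pt_inj.
apply: (tri_side_uniq TZ TW).
have SN : (- S == S) = false by apply/eqP; move: S_gt0; lra.
by case: (tri_area TZ) (tri_area TW) e => -> [] ->; rewrite ?eqxx ?SN.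
Qed.

(** [lform i] cannot be constant on three noncollinear points, so line [i] is not parallel to every
    side and meets the line of some side in a vertex. *)
Lemma nonempty_line p q x i : tri p q x -> exists P, on i (pt P).
Proof.
have K p1 p2 y : tri p1 p2 y -> lform i p1 != lform i p2 -> exists P, on i (pt P).
  move=> T n12; case/and4P: (T) => /connP[j j1 j2] _ _ _.
  have [ij|nij] := eqVneq i j.
    by have [P eP] := tri_vertex T; exists P; rewrite eP ij.
  pose t := lform i p1 / (lform i p1 - lform i p2).
  have it : on i (pointAt p1 p2 t).
    by rewrite /on lform_pointAt /t; apply/eqP; field; rewrite subr_eq0.
  by have [P eP] := pt_complete nij it (on_pointAt t j1 j2); exists P; rewrite eP.
move=> T; have [e1|n1] := eqVneq (lform i p) (lform i q); last exact: (K p q x).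
have [e2|n2] := eqVneq (lform i p) (lform i x); last by apply: (K p x q) => //; rewrite triCr.
have Tn := tri_area_neq0 T.
have f1 : a i * area2 p q x = 0.
  transitivity ((lform i q - lform i p) * (x.2 - p.2) - (lform i x - lform i p) * (q.2 - p.2)).
    by rewrite /area2 /lform; ring.
  by rewrite -e1 -e2 !subrr !mul0r subrr.
have f2 : b i * area2 p q x = 0.
  transitivity ((lform i x - lform i p) * (q.1 - p.1) - (lform i q - lform i p) * (x.1 - p.1)).
    by rewrite /area2 /lform; ring.
  by rewrite -e1 -e2 !subrr !mul0r subrr.
move/eqP: f1; move/eqP: f2; rewrite !mulf_eq0 (negbTE Tn) !orbF => h1 h2.
by move: (coef_neq0 i); rewrite h1 h2.
Qed.

Lemma nbrs_total lt i P0 : (forall P, on i (pt P) -> #|nbrs lt i P| <= 1)%N ->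
  on i (pt P0) -> nbrs lt i P0 = finset.set0 ->
  (\sum_(P | on i (pt P)) #|nbrs lt i P| + 1 <= \sum_P on i (pt P))%N.
Proof.
move=> le1 i0 e0; rewrite (bigD1 P0) //= e0 cards0 add0n addnC.
rewrite [X in (_ <= X)%N](bigD1 P0) //= i0 leq_add2l.
rewrite [X in (X <= _)%N]big_mkcond [X in (_ <= X)%N]big_mkcond; apply: leq_sum => P _.
by case: (boolP (on i (pt P))) => [iP|]; case: (P != P0); rewrite ?le1.
Qed.

(** The first vertex of the line has no neighbour before it and the last none after it, which saves
    2. *)
Lemma line_edges i : (exists P, on i (pt P)) ->
  (\sum_(P | on i (pt P)) \sum_(Q | on i (pt Q)) edgeb P Q + 2
    <= 2 * \sum_P on i (pt P))%N.
Proof.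
case=> P1 i1.
apply: (@leq_trans (\sum_(P | on i (pt P)) (#|nbrs <%R i P| + #|nbrs >%R i P|) + 2)).
  by rewrite leq_add2r; apply: leq_sum => P iP; apply: edges_at.
rewrite big_split /= mul2n -addnn -[X in (_ + X <= _)%N]/(1 + 1)%N addnACA.
apply: leq_add.
  have [P0 i0 min0] := @arg_minP _ R _ P1 (fun P => on i (pt P)) (fun P => kappa i (pt P)) i1.
  apply: (nbrs_total _ i0); first exact: nbrs_lt_le1.
  apply/setP => Q; rewrite !inE; apply/negP => /and3P[iQ _].
  by rewrite ltNge min0.
have [P0 i0 max0] := @arg_maxP _ R _ P1 (fun P => on i (pt P)) (fun P => kappa i (pt P)) i1.
apply: (nbrs_total _ i0); first exact: nbrs_gt_le1.
apply/setP => Q; rewrite !inE; apply/negP => /and3P[iQ _].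
by move=> /=; rewrite ltNge; move/negP; apply; exact: max0.
Qed.

(** [line_edges] is summed over the lines; the given triangle ensures that every line has a vertex
    and so yields its saving. *)
Lemma edge_sum : (exists p q x, tri p q x) ->
  (\sum_P \sum_Q edgeb P Q + 2 * n <= 2 * \sum_P mult (pt P))%N.
Proof.
move=> [p [q [x T]]].
have multE P : mult (pt P) = (\sum_i on i (pt P))%N.
  by rewrite /mult -sum1_card big_mkcond; apply: eq_bigr => i _; rewrite inE; case: on.
under [X in (_ <= 2 * X)%N]eq_bigr do rewrite multE.
rewrite [X in (_ <= 2 * X)%N]exchange_big [X in (_ <= X)%N]big_distrr /=.
have -> : (2 * n = \sum_(i < n) 2)%N by rewrite sum_nat_const card_ord mulnC.
apply: (@leq_trans (\sum_(i < n)
    (\sum_(P | on i (pt P)) \sum_(Q | on i (pt Q)) edgeb P Q + 2))); last first.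
  by apply: leq_sum => i _; apply: line_edges; apply: nonempty_line T.
rewrite big_split leq_add2r /=.
under [X in (_ <= X)%N]eq_bigr do rewrite big_mkcond.
rewrite [X in (_ <= X)%N]exchange_big; apply: leq_sum => P _ /=.
under [X in (_ <= X)%N]eq_bigr do rewrite big_mkcond.
rewrite -[X in (_ <= X)%N]big_mkcond [X in (_ <= X)%N]exchange_big; apply: leq_sum => Q _ /=.
case: (boolP (edgeb P Q)) => // /edgeb_on [i iP iQ].
by rewrite (bigD1 i) //= iQ.
Qed.

(** Ordered pairs of distinct lines are counted by their common vertex, of which there is at most
    one. *)
Lemma pair_sum :
  (\sum_P mult (pt P) * (mult (pt P) - 1) <= n * (n - 1))%N.
Proof.
have cnt (A : {set 'I_n}) :
    (#|A| * (#|A| - 1) = \sum_i \sum_(j | j != i) ((i \in A) * (j \in A)))%N.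
  rewrite -sum_nat_const big_mkcond; apply: eq_bigr => i _.
  case: (boolP (i \in A)) => iA; last by rewrite big1.
  rewrite (cardsD1 i) iA addnC addnK -sum1_card big_mkcond [RHS]big_mkcond.
  apply: eq_bigr => j _; rewrite !inE.
  by case: (j != i); case: (j \in A).
under eq_bigr do rewrite /mult cnt.
rewrite exchange_big /=.
have -> : (n * (n - 1) = \sum_(i < n) \sum_(j < n | j != i) 1)%N.
  rewrite -{1}(card_ord n) -sum_nat_const; apply: eq_bigr => i _.
  rewrite sum1_card (eq_card (B := [set~ i])).
    by rewrite cardsC1 card_ord subn1.
  by move=> j; rewrite !inE.
apply: leq_sum => i _; rewrite exchange_big /=; apply: leq_sum => j nji.
have -> : (\sum_P (i \in [set i0 | on i0 (pt P)]) * (j \in [set i0 | on i0 (pt P)]) =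
   #|[set P | on i (pt P) && on j (pt P)]|)%N.
  rewrite -sum1_card [RHS]big_mkcond; apply: eq_bigr => P _; rewrite !inE.
  by do 2 case: on.
apply/card_le1_eqP => P Q; rewrite !inE => /andP[iP jP] /andP[iQ jQ].
apply: contraNeq nji => nPQ; apply/eqP/esym.
by apply: (line_uniq (p := pt P) (q := pt Q)) => //; rewrite (inj_eq pt_inj) eq_sym.
Qed.

Lemma tri_count : (exists p q x, tri p q x) ->
  (\sum_P \sum_Q \sum_X tri (pt P) (pt Q) (pt X) + 2 * n <= 2 * (n * (n - 1)))%N.
Proof.
move=> ex.
apply: (@leq_trans (\sum_P \sum_Q edgeb P Q + \sum_P \sum_Q dblb P Q + 2 * n)).
  rewrite leq_add2r -big_split; apply: leq_sum => P _ /=.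
  by rewrite -big_split; apply: leq_sum => Q _; apply: third_vertices.
rewrite addnAC; apply: leq_trans (leq_add (edge_sum ex) dbl_sum) _.
rewrite -big_distrr -mulnDr leq_mul2l -big_split /=.
apply: leq_trans pair_sum; apply: leq_sum => P _.
(* This is m + m (m - 2) = m (m - 1). *)
by case: (mult (pt P)) (mult_pt P) => [|[|m]] // _; rewrite !subSS !subn0 -mulnS.
Qed.

(** * From ordered triples of vertices to sets of lines *)

Definition sides (t : V * V * V) : {set 'I_n} :=
  [set l | [|| on l (pt t.1.1) && on l (pt t.1.2), on l (pt t.1.2) && on l (pt t.2)
            | on l (pt t.1.1) && on l (pt t.2)]].

Definition triangle_on (T : {set 'I_n}) : Prop :=
  exists i j k p q x, [/\ T = [set i; j; k], tri p q x, on i q && on i x,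
    on j p && on j x & on k p && on k q].

(** The six orderings of the vertices all have the side set [T]. *)
Lemma triangle_fiber T : triangle_on T ->
  (6 <= #|[set t : V * V * V | tri (pt t.1.1) (pt t.1.2) (pt t.2) && (sides t == T)]|)%N.
Proof.
move=> [i [j [k [p [q [x [TE Tr /andP[iq ix] /andP[jp jx] /andP[kp kq]]]]]]]].
have Trq : tri q x p by rewrite triCr triC.
have Trx : tri x p q by rewrite triC triCr.
have [P eP] := tri_vertex Tr; have [Q eQ] := tri_vertex Trq.
have [X eX] := tri_vertex Trx.
have npq := area2_neq (tri_area_neq0 Tr).
have nqx := area2_neq (tri_area_neq0 Trq).
have nxp := area2_neq (tri_area_neq0 Trx).
have sE : sides (P, Q, X) = T.
  apply/setP => l; rewrite TE !inE /= eP eQ eX; apply/idP/idP.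
    case/or3P=> /andP[l1 l2].
    - by rewrite (line_uniq npq l1 l2 kp kq) eqxx !orbT.
    - by rewrite (line_uniq nqx l1 l2 iq ix) eqxx.
    - by rewrite (line_uniq nxp l2 l1 jx jp) eqxx !orbT.
  by case/orP=> [/orP[]|] /eqP ->; rewrite ?iq ?ix ?jp ?jx ?kp ?kq ?orbT.
have NPQ : P != Q by apply: contraNneq npq => e; rewrite -eP -eQ e.
have NQX : Q != X by apply: contraNneq nqx => e; rewrite -eQ -eX e.
have NXP : X != P by apply: contraNneq nxp => e; rewrite -eP -eX e.
pose s := [:: (P, Q, X); (P, X, Q); (Q, P, X); (Q, X, P); (X, P, Q); (X, Q, P)].
have us : uniq s.
  rewrite /= !inE !xpair_eqE !(negbTE NPQ) !(negbTE NQX) !(negbTE NXP).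
  rewrite !(eq_sym Q P) !(eq_sym X Q) !(eq_sym P X).
  by rewrite !(negbTE NPQ) !(negbTE NQX) !(negbTE NXP) !andbF !orbF.
rewrite -[6%N]/(size s) cardE; apply: uniq_leq_size => // t.
have Tr1 : tri p x q by rewrite triCr.
have Tr2 : tri q p x by rewrite triC.
have Tr3 : tri x q p by rewrite triCr.
rewrite mem_enum !inE -sE.
by case/orP=> [|/orP[|/orP[|/orP[|/orP[]]]]] /eqP -> /=;
  rewrite ?eP ?eQ ?eX ?Tr ?Tr1 ?Tr2 ?Tr3 ?Trx ?Trq /=;
  apply/eqP/setP => l; rewrite !inE /= ?eP ?eQ ?eX;
  case: (on l p); case: (on l q); case: (on l x).
Qed.

Lemma triangle_bound (M : {set {set 'I_n}}) :
  (forall T, T \in M -> triangle_on T) -> (3 * #|M| <= n * (n - 2))%N.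
Proof.
move=> MT; case: (set_0Vmem M) => [->|[T0 T0M]]; first by rewrite cards0 muln0.
have ex : exists p q x, tri p q x.
  by case: (MT _ T0M) => i [j [k [p [q [x [_ T _ _ _]]]]]]; exists p, q, x.
have := tri_count ex.
have le6 : (6 * #|M| <= \sum_P \sum_Q \sum_X tri (pt P) (pt Q) (pt X))%N.
  rewrite pair_bigA pair_bigA /=.
  rewrite mulnC -sum_nat_const.
  apply: (@leq_trans (\sum_(T in M) \sum_(t : V * V * V)
      (tri (pt t.1.1) (pt t.1.2) (pt t.2) && (sides t == T)))).
    apply: leq_sum => T TM; apply: leq_trans (triangle_fiber (MT _ TM)) _.
    rewrite -sum1_card big_mkcond; apply: leq_sum => t _.
    by rewrite inE; case: (_ && _).
  rewrite exchange_big; apply: leq_sum => t _ /=.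
  case: tri => /=; last by rewrite big1.
  apply: (@leq_trans (\sum_(T : {set 'I_n}) (sides t == T))).
    by rewrite [X in (_ <= X)%N](bigID (mem M)) leq_addr.
  by rewrite (bigD1 (sides t)) //= eqxx big1 // => T /negbTE; rewrite eq_sym => ->.
by move=> h; apply: six_count_bound; apply: leq_trans (leq_add le6 (leqnn _)) h.
Qed.

End Counting.

End Geometry.

(** * Upper bound *)

Section UpperBound.
Variables (R : realType) (n : nat) (L : 'I_n -> set (plane R)).
Hypothesis arrL : is_arrangement L.

Lemma line_coefs : exists f : 'I_n -> R * R * R, forall i,
  (((f i).1.1 != 0) || ((f i).1.2 != 0)) /\
  forall p, L i p <-> (f i).1.1 * p.1 + (f i).1.2 * p.2 = (f i).2.
Proof.
suff /choice[f fP] : forall i, exists t : R * R * R,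
    ((t.1.1 != 0) || (t.1.2 != 0)) /\
    forall p, L i p <-> t.1.1 * p.1 + t.1.2 * p.2 = t.2 by exists f.
move=> i; have [a [b [c [ab Li]]]] := arrL.1 i.
exists (a, b, c); split=> /=; last by move=> p; rewrite Li.
by rewrite -negb_and; apply/negP => /andP[/eqP a0 /eqP b0]; apply: ab; rewrite a0 b0.
Qed.

Lemma upper_bound : (3 * #|min_area_triangles L| <= n * (n - 2))%N.
Proof.
have [f fP] := line_coefs.
pose a i := (f i).1.1; pose b i := (f i).1.2; pose c i := (f i).2.
have nz i : (a i != 0) || (b i != 0) by have [] := fP i.
have onE i p : on a b c i p <-> L i p.
  have [_ ->] := fP i; by rewrite /on /lform subr_eq0; split=> /eqP.
have luniq i j p q : p != q -> on a b c i p -> on a b c i q ->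
    on a b c j p -> on a b c j q -> i = j.
  move=> npq ip iq jp jq; apply: arrL.2; apply/seteqP.
  by split=> x /onE ox; apply/onE; apply: (on_collinear npq) => //; apply: area2_on ox => //.
case: (set_0Vmem (min_area_triangles L)) => [->|[T0]]; first by rewrite cards0 muln0.
rewrite inE => /asboolP[s [T0s smin]].
have notpar i j p q : on a b c i p -> on a b c j p -> on a b c j q -> ~~ on a b c i q ->
    ~ parallel (L i) (L j).
  move=> ip jp jq niq [e|e].
    by case/negP: niq; apply/onE; rewrite e; apply/onE.
  by have : (L i `&` L j)%classic p; [split; apply/onE | rewrite e].
have tri_forms i j k p q x : on a b c i q -> on a b c i x -> on a b c j p -> on a b c j x ->
    on a b c k p -> on a b c k q -> area2 p q x != 0 -> forms_triangle (L i) (L j) (L k).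
  move=> iq ix jp jx kp kq nz0.
  have nip : ~~ on a b c i p by apply: contraNN nz0 => ip; apply/eqP; apply: area2_on ip iq ix.
  have njq : ~~ on a b c j q by apply: contraNN nz0 => jq; apply/eqP; apply: area2_on jp jq jx.
  have nkx : ~~ on a b c k x by apply: contraNN nz0 => kx; apply/eqP; apply: area2_on kp kq kx.
  split.
  - exact: (notpar i j x p).
  - exact: (notpar j k p q).
  - exact: (notpar i k q p).
  apply/seteqP; split=> // y [[/onE iy /onE jy] /onE ky].
  have [exy|nxy] := eqVneq x y; first by case/negP: nkx; rewrite exy.
  by case/negP: nip; rewrite (luniq _ _ _ _ nxy ix iy jx jy).
have area_gt0 T t : triangle_of_area L T t -> exists i j k p q x,
    [/\ T = [set i; j; k]%SET, on a b c i q && on a b c i x,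
        on a b c j p && on a b c j x, on a b c k p && on a b c k q
      & 0 < `|area2 p q x| /\ t = `|area2 p q x| / 2].
  move=> [i [j [k [TE [_ _ _ conc] [A [B [C [[jA kA] [iB kB] [iC jC] tE]]]]]]]].
  exists i, j, k, A, B, C; split=> //; try by apply/andP; split; apply/onE.
  split=> //; rewrite normr_gt0; apply/negP => /eqP e0.
  have [eAB|nAB] := eqVneq A B.
    have : (L i `&` L j `&` L k)%classic A by rewrite eAB in jA *; do !split.
    by rewrite conc.
  have : on a b c k C by apply: (on_collinear nAB) e0; apply/onE.
  move/onE => kC; have : (L i `&` L j `&` L k)%classic C by do !split.
  by rewrite conc.
have s_gt0 : 0 < s * 2.
  have [_ [_ [_ [p [q [x [_ _ _ _ [h ->]]]]]]]] := area_gt0 _ _ T0s.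
  by rewrite divfK ?pnatr_eq0.
have Smin p q x : conn a b c p q -> conn a b c q x -> conn a b c p x ->
    area2 p q x != 0 -> s * 2 <= `|area2 p q x|.
  move=> /connP[k kp kq] /connP[i iq ix] /connP[j jp jx] nz0.
  rewrite -ler_pdivlMr //; apply: (smin [set i; j; k]%SET).
  exists i, j, k; split=> //; first exact: (tri_forms i j k p q x).
  by exists p, q, x; split=> //; split; apply/onE.
(* The vertices form a finite type: one meeting point is chosen for each pair of distinct lines that
   has one, and by [luniq] there is no other. *)
pose meet i j p := [&& i != j, on a b c i p & on a b c j p].
pose inter (ij : 'I_n * 'I_n) : option (R * R) :=
  if pselect (exists p, meet ij.1 ij.2 p) is left h then Some (xchoose h) else None.
pose vs := pmap inter (enum {: 'I_n * 'I_n}).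
have vsP p : p \in vs <-> exists i j, meet i j p.
  rewrite mem_pmap; split.
    case/mapP=> -[i j] _; rewrite /inter; case: pselect => // h [->].
    by exists i, j; apply: (xchooseP h).
  move=> [i [j m]]; apply/mapP; exists (i, j); first by rewrite mem_enum.
  rewrite /inter; case: pselect => [h|]; last by case; exists p.
  congr Some; have /and3P[nij i1 j1] := m; have /and3P[_ i2 j2] := xchooseP h.
  apply/eqP; apply: contraNT nij => npq; apply/eqP.
  exact: (luniq _ _ _ _ npq).
apply: (@triangle_bound _ _ a b c (s * 2) nz luniq s_gt0 Smin (seq_sub vs) (@ssval _ vs)).
- exact: val_inj.
- move=> P; have /vsP[i [j /and3P[nij ip jp]]] := valP P.
  by apply/card_gt1P; exists i, j; rewrite !inE.
- move=> i j p nij ip jp.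
  have pv : p \in vs by apply/vsP; exists i, j; rewrite /meet nij ip.
  by exists (SeqSub pv).
move=> T; rewrite inE => /asboolP[t [Tt tmin]].
have ts : t = s by apply/eqP; rewrite eq_le (tmin _ _ T0s) (smin _ _ Tt).
have [i [j [k [p [q [x [TE h1 h2 h3 [_ tE]]]]]]]] := area_gt0 _ _ Tt.
exists i, j, k, p, q, x; split=> //; rewrite /tri -ts tE divfK ?pnatr_eq0 // eqxx andbT.
move: h1 h2 h3 => /andP[h11 h12] /andP[h21 h22] /andP[h31 h32].
by rewrite (conn_on h31 h32) (conn_on h11 h12) (conn_on h21 h22).
Qed.

End UpperBound.

(** * Lower bound *)

Lemma sum_lt_tail (p x : nat) :
  (2 * \sum_(a < p) \sum_(b < p) (a + b < x) <= x * x.+1)%N.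
Proof.
have row (q y : nat) : (\sum_(b < q) (b < y) <= y)%N.
  elim: q => [|q IH]; first by rewrite big_ord0.
  have [yq|qy] := leqP y q; first by rewrite big_ord_recr /= ltnNge yq addn0.
  apply: leq_trans qy; rewrite -[X in (_ <= X)%N](card_ord q.+1) -sum1_card.
  by apply: leq_sum => b _; case: (_ < _)%N.
apply: (@leq_trans (2 * \sum_(a < p) (x - a))).
  rewrite leq_mul2l; apply: leq_sum => a _.
  by under eq_bigr do rewrite -ltn_subRL; apply: row.
(* The extra term is twice the part of the triangular number beyond row [p]; it makes the induction
   go through. *)
have : (2 * \sum_(a < p) (x - a) + (x - p) * (x - p).+1 <= x * x.+1)%N.
  elim: p => [|p IH]; first by rewrite big_ord0 muln0 subn0.
  rewrite big_ord_recr /=; apply: leq_trans IH; move: (\sum_(a < p) (x - a))%N => t.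
  case: (ltnP p x) => h; last first.
    have [-> ->] : (x - p.+1 = 0 /\ x - p = 0)%N by lia.
    by rewrite addn0.
  by have [m ->] : exists m, x = (p.+1 + m)%N by [exists (x - p.+1)%N; lia]; nia.
by apply: leq_trans; rewrite leq_addr.
Qed.

(** Sums below the window account for at most x (x + 1) / 2 + x (x - 1) / 2 = x^2 failures.
    Reversing both coordinates turns [a + b] into [2 * p - 2 - (a + b)] and gives [y ^ 2] for those
    above. *)
Lemma window_count (p x y r : nat) : (x + r + y = 2 * p)%N ->
  (2 * p ^ 2 <= \sum_(a < p) \sum_(b < p)
     ((x <= a + b < x + r) + (x <= (a + b).+1 < x + r)) + (x ^ 2 + y ^ 2))%N.
Proof.
move=> e.
have revS (F : nat -> nat) : (\sum_(a < p) \sum_(b < p) F (a + b) =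
    \sum_(a < p) \sum_(b < p) F (2 * p - 2 - (a + b)))%N.
  rewrite (reindex_inj rev_ord_inj); apply: eq_bigr => a _.
  rewrite (reindex_inj rev_ord_inj); apply: eq_bigr => b _ /=; congr F.
  by move: (ltn_ord a) (ltn_ord b); lia.
pose g z := (\sum_(a < p) \sum_(b < p) (a + b < z))%N.
have tail z : (g z + g z.-1 <= z ^ 2)%N.
  have := sum_lt_tail p z; have := sum_lt_tail p z.-1; rewrite -/(g _) -/(g _).
  by case: z => [|z] /=; nia.
have -> : (2 * p ^ 2 = \sum_(a < p) \sum_(b < p) 2)%N.
  by rewrite !sum_nat_const !card_ord -mulnn [LHS]mulnC mulnA.
apply: (@leq_trans (\sum_(a < p) \sum_(b < p)
     ((x <= a + b < x + r) + (x <= (a + b).+1 < x + r)) +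
     ((g x + g x.-1) + (g y + g y.-1)))); last by rewrite leq_add2l leq_add.
have gE1 : g y = (\sum_(a < p) \sum_(b < p) (2 * p - 2 - (a + b) < y))%N.
  exact: (revS (fun m => (m < y)%N : nat)).
have gE2 : g y.-1 = (\sum_(a < p) \sum_(b < p) (2 * p - 2 - (a + b) < y.-1))%N.
  exact: (revS (fun m => (m < y.-1)%N : nat)).
rewrite gE1 gE2 /g -!big_split /=; apply: leq_sum => a _.
rewrite -!big_split /=; apply: leq_sum => b _.
have := ltn_ord a; have := ltn_ord b; move: (nat_of_ord a) (nat_of_ord b) => {}a {}b bp ap.
have h1 : (1 <= (x <= a + b < x + r) + (a + b < x) + (2 * p - 2 - (a + b) < y.-1))%N.
  case: (ltnP (a + b) x) => h1 /=; first by rewrite addn1.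
  case: (ltnP (a + b) (x + r)) => // h2 /=; rewrite add0n lt0b; lia.
have h2 : (1 <= (x <= (a + b).+1 < x + r) + (a + b < x.-1) + (2 * p - 2 - (a + b) < y))%N.
  case: (ltnP (a + b) x.-1) => h2 /=; first by rewrite addn1.
  have h3 : (x <= (a + b).+1)%N by lia.
  rewrite h3; case: (ltnP (a + b).+1 (x + r)) => // h4 /=; rewrite add0n lt0b; lia.
by move: h1 h2; do 6 move: (nat_of_bool _) => ?; clear; lia.
Qed.

(** * Three parallel classes of lines *)

Section Construction.
Variables (R : realType) (p r x : nat).
Local Notation N := (p + p + r)%N.

(** Normal vectors of the lines, in index blocks of lengths [p], [p], [r]. *)
Definition dir (i : nat) : R * R :=
  if (i < p)%N then (1, 0) else if (i < p + p)%N then (0, 1) else (1, 1).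

(* The shift by 1/2 rules out concurrent triples. *)
Definition offset (i : nat) : R :=
  if (i < p)%N then i%:R else if (i < p + p)%N then (i - p)%:R
  else (x + (i - (p + p)))%:R - 1 / 2.

Definition grid (i : 'I_N) : set (plane R) :=
  [set q : plane R | (dir i).1 * q.1 + (dir i).2 * q.2 = offset i].

Lemma dirE (i : nat) : [\/ (i < p)%N /\ dir i = (1, 0),
  [/\ (p <= i)%N, (i < p + p)%N & dir i = (0, 1)] | (p + p <= i)%N /\ dir i = (1, 1)].
Proof.
rewrite /dir; case: ltnP => h1; first by constructor 1.
by case: ltnP => h2; [constructor 2 | constructor 3].
Qed.

Lemma dir_offset_inj (i j : 'I_N) : dir i = dir j -> offset i = offset j -> i = j.
Proof.
rewrite /dir /offset => e1 e2; apply: ord_inj; move: e1 e2.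
case: (ltnP i p) => i1; [|case: (ltnP i (p + p)) => i2];
  (case: (ltnP j p) => j1; [|case: (ltnP j (p + p)) => j2]) => //=;
  try by case=> /eqP; rewrite ?oner_eq0 // eq_sym oner_eq0.
- by move=> _ /eqP; rewrite eqr_nat => /eqP.
- by move=> _ /eqP; rewrite eqr_nat => /eqP; move: i1 j1; lia.
- by move=> _ /addIr/eqP; rewrite eqr_nat => /eqP; move: i2 j2; lia.
Qed.

Lemma grid_arrangement : is_arrangement grid.
Proof.
split=> [i|i j e].
  exists (dir i).1, (dir i).2, (offset i); split=> //; rewrite -surjective_pairing.
  by case: (dirE i) => [[_ ->]|[_ _ ->]|[_ ->]] [] /eqP;
    rewrite ?oner_eq0 // => _ /eqP; rewrite oner_eq0.
(* Two points of line [i], for [t] = 0 and 1; lying on line [j] too, they force equal normals. *)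
have key t : exists q : plane R,
    (dir i).1 * q.1 + (dir i).2 * q.2 = offset i /\ (dir i).2 * q.1 - (dir i).1 * q.2 = t.
  case: (dirE i) => [[_ ->]|[_ _ ->]|[_ ->]] /=.
  - by exists (offset i, - t); split=> /=; ring.
  - by exists (t, offset i); split=> /=; ring.
  - by exists ((offset i + t) / 2, (offset i - t) / 2); split=> /=; field.
have [q0 [h0 k0]] := key 0; have [q1 [h1 k1]] := key 1.
have j0 : grid j q0 by rewrite -e.
have j1 : grid j q1 by rewrite -e.
rewrite /grid /= in j0 j1.
suff ed : dir i = dir j.
  by apply: dir_offset_inj => //; rewrite -j0 -h0 ed.
move: h0 k0 h1 k1 j0 j1; clear e key.
by case: (dirE i) => [[_ ->]|[_ _ ->]|[_ ->]]; case: (dirE j) => [[_ ->]|[_ _ ->]|[_ ->]] //=;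
  move=> *; exfalso; lra.
Qed.

(** The classical formula, squared determinant of the three line equations over the product of the
    minors, obtained by solving for each vertex by Cramer's rule. *)
Lemma area2_sides (d1 d2 d3 : R * R) (c1 c2 c3 : R) (A B C : R * R) :
  d2.1 * A.1 + d2.2 * A.2 = c2 -> d3.1 * A.1 + d3.2 * A.2 = c3 ->
  d1.1 * B.1 + d1.2 * B.2 = c1 -> d3.1 * B.1 + d3.2 * B.2 = c3 ->
  d1.1 * C.1 + d1.2 * C.2 = c1 -> d2.1 * C.1 + d2.2 * C.2 = c2 ->
  cross d1 d2 != 0 -> cross d2 d3 != 0 -> cross d3 d1 != 0 ->
  area2 A B C = (c1 * cross d2 d3 + c2 * cross d3 d1 + c3 * cross d1 d2) ^+ 2 /
    (cross d1 d2 * cross d2 d3 * cross d3 d1).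
Proof.
move=> A2 A3 B1 B3 C1 C2 n12 n23 n31.
have solve (d e : R * R) (u v : R) (q : R * R) : cross d e != 0 ->
    d.1 * q.1 + d.2 * q.2 = u -> e.1 * q.1 + e.2 * q.2 = v ->
    q.1 = (u * e.2 - v * d.2) / cross d e /\ q.2 = (v * d.1 - u * e.1) / cross d e.
  move=> nz <- <-; rewrite /cross in nz *; by split; field.
rewrite /area2; have [-> ->] := solve _ _ _ _ _ n12 C1 C2.
have [-> ->] := solve _ _ _ _ _ n23 A2 A3.
have [-> ->] := solve _ _ _ _ _ n31 B3 B1.
by rewrite /cross in n12 n23 n31 *; field; rewrite n12 n23 n31.
Qed.

Lemma half_sqr (u v : nat) : 4^-1 <= (u%:R - v%:R - 1 / 2 : R) ^+ 2.
Proof.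
case: (leqP u v) => h.
  have : (u%:R <= v%:R :> R) by rewrite ler_nat.
  by move: (u%:R) (v%:R) => s t; nra.
have : (v%:R + 1 <= u%:R :> R) by rewrite natr1 ler_nat.
by move: (u%:R) (v%:R) => s t; nra.
Qed.

Lemma dir_parallel (i j : 'I_N) : dir i = dir j -> parallel (grid i) (grid j).
Proof.
move=> e; have [eo|no] := eqVneq (offset i) (offset j).
  by left; rewrite (dir_offset_inj e eo).
right; apply/seteqP; split=> // q [/= h1 h2]; case/eqP: no.
by rewrite -h1 -h2 e.
Qed.

(** A triangle takes one line from each class, so the minors are 1 or -1 and the determinant is, up
    to sign, an integer minus 1/2. *)
Lemma grid_area_ge T s : triangle_of_area grid T s -> 1 / 8 <= s.
Proof.
move=> [i [j [k [_ [nij njk nik _] [A [B [C [[jA kA] [iB kB] [iC jC] ->]]]]]]]].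
rewrite /triangle_area -/(area2 A B C).
suff h : 4^-1 <= `|area2 A B C| by move: h; lra.
have {}nij : dir i <> dir j by move/dir_parallel.
have {}njk : dir j <> dir k by move/dir_parallel.
have {}nik : dir i <> dir k by move/dir_parallel.
have := area2_sides jA kA iB kB iC jC.
have main (D e : R) : (exists u v : nat, D = u%:R - v%:R - 1 / 2 \/ D = - (u%:R - v%:R - 1 / 2)) ->
    e = 1 \/ e = -1 -> 4^-1 <= `|D ^+ 2 / e|.
  move=> [u [v uv]] ee.
  have -> : `|D ^+ 2 / e| = (u%:R - v%:R - 1 / 2) ^+ 2.
    have -> : `|D ^+ 2 / e| = D ^+ 2.
      case: ee => ->; first by rewrite divr1 ger0_norm ?sqr_ge0.
      by rewrite invrN1 mulrN1 normrN ger0_norm ?sqr_ge0.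
    by case: uv => ->; rewrite ?sqrrN.
  exact: half_sqr.
have half (i1 i2 i3 : 'I_N) : (i1 < p)%N -> (p <= i2)%N -> (i2 < p + p)%N -> (p + p <= i3)%N ->
    exists u v : nat, offset i3 - offset i1 - offset i2 = u%:R - v%:R - 1 / 2.
  move=> h1 h2 h3 h4; exists (x + (i3 - (p + p)))%N, (i1 + (i2 - p))%N.
  rewrite /offset h1 (ltnNge i2) h2 h3 (ltnNge i3 (p + p)) h4 /= (ltnNge i3 p).
  by rewrite (leq_trans (leq_addr _ _) h4) /= natrD; ring.
case: (dirE i) => [[hi ei]|[hi hi' ei]|[hi ei]];
  case: (dirE j) => [[hj ej]|[hj hj' ej]|[hj ej]];
  try (by case: nij; rewrite ei ej);
  case: (dirE k) => [[hk ek]|[hk hk' ek]|[hk ek]];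
  try (by case: nik; rewrite ei ek); try (by case: njk; rewrite ej ek);
  rewrite ei ej ek /cross /= ?mul1r ?mul0r ?mulr0 ?mulr1 ?subr0 ?sub0r ?subrr
    ?oppr_eq0 ?oner_eq0 => /(_ isT isT isT) ->; apply: main; try (by [left; ring|right; ring]);
  first [have [u [v h]] := half _ _ _ hi hj hj' hk | have [u [v h]] := half _ _ _ hi hk hk' hj
    | have [u [v h]] := half _ _ _ hj hi hi' hk | have [u [v h]] := half _ _ _ hj hk hk' hi
    | have [u [v h]] := half _ _ _ hk hi hi' hj | have [u [v h]] := half _ _ _ hk hj hj' hi];
  exists u, v; rewrite -h; by [left; ring | right; ring].
Qed.

Definition vline (a : 'I_p) : 'I_N := lshift r (lshift p a).
Definition hline (b : 'I_p) : 'I_N := lshift r (rshift p b).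
Definition dline (k : 'I_r) : 'I_N := rshift (p + p) k.

Lemma gridV a (q : plane R) : grid (vline a) q <-> q.1 = a%:R.
Proof.
rewrite /grid /dir /offset /= ltn_ord.
by split; rewrite /= mul1r mul0r addr0.
Qed.

Lemma gridH b (q : plane R) : grid (hline b) q <-> q.2 = b%:R.
Proof.
rewrite /grid /dir /offset /= ltnNge leq_addr ltn_add2l ltn_ord addKn /=.
by split; rewrite /= mul1r mul0r add0r.
Qed.

Lemma gridD k (q : plane R) : grid (dline k) q <-> q.1 + q.2 = (x + k)%:R - 1 / 2.
Proof.
rewrite /grid /dir /offset /= (ltnNge _ (p + p)) leq_addr ltnNge -addnA leq_addr addnA addKn /=.
by split; rewrite /= !mul1r.
Qed.

Lemma grid_not_parallel (i j : 'I_N) q :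
  (i : nat) <> j -> grid i q -> grid j q -> ~ parallel (grid i) (grid j).
Proof.
move=> nij iq jq [/grid_arrangement.2 e|e]; first by apply: nij; rewrite e.
by have : (grid i `&` grid j)%classic q by []; rewrite e.
Qed.

Lemma grid_min_triangle (a b : 'I_p) (k : 'I_r) :
  (a + b == x + k)%N || ((a + b).+1 == x + k)%N ->
  [set vline a; hline b; dline k]%SET \in min_area_triangles grid.
Proof.
move=> h; set w : R := (x + k)%:R - 1 / 2.
(* The signed leg of the right isosceles triangle with its right angle at (a, b). *)
have wE : w - a%:R - b%:R = - (1 / 2) \/ w - a%:R - b%:R = 1 / 2.
  by rewrite /w; case/orP: h => /eqP <-;
    [left; rewrite natrD | right; rewrite -(natr1 (a + b)) natrD]; field.
rewrite inE; apply/asboolP; exists (1 / 8); split; last by move=> T s; apply: grid_area_ge.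
have vA : grid (vline a) (a%:R, w - a%:R) by apply/gridV.
have dA : grid (dline k) (a%:R, w - a%:R) by apply/gridD => /=; rewrite addrCA subrr addr0.
have hB : grid (hline b) (w - b%:R, b%:R) by apply/gridH.
have dB : grid (dline k) (w - b%:R, b%:R) by apply/gridD => /=; rewrite subrK.
have vC : grid (vline a) (a%:R, b%:R) by apply/gridV.
have hC : grid (hline b) (a%:R, b%:R) by apply/gridH.
have ap := ltn_ord a; have bp := ltn_ord b.
exists (vline a), (hline b), (dline k); split=> //.
  split.
  - apply: (grid_not_parallel _ vC hC) => /= e.
    by move: ap; rewrite e ltnNge leq_addr.
  - apply: (grid_not_parallel _ hB dB) => /= e.
    by move: bp; rewrite -(ltn_add2l p) e ltnNge leq_addr.
  - apply: (grid_not_parallel _ vA dA) => /= e.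
    by move: ap; rewrite e ltnNge -addnA leq_addr.
  apply/seteqP; split=> // q [[/gridV e1 /gridH e2] /gridD]; rewrite e1 e2 -/w.
  by case: wE => e3 e4; lra.
exists (w - b%:R, b%:R), (a%:R, w - a%:R), (a%:R, b%:R); split=> //.
rewrite /triangle_area /=.
have -> : (a%:R - (w - b%:R)) * (b%:R - b%:R) - (a%:R - (w - b%:R)) * (w - a%:R - b%:R) =
    (w - a%:R - b%:R) ^+ 2 by ring.
by rewrite ger0_norm ?sqr_ge0 //; case: wE => ->; field.
Qed.

Lemma window_sum (m : nat) : ((x <= m < x + r) <= \sum_(k < r) (m == x + k))%N.
Proof.
case: (boolP (x <= m < x + r)%N) => // /andP[h1 h2].
have kr : (m - x < r)%N by rewrite ltn_subLR.
by rewrite (bigD1 (Ordinal kr)) //= subnKC // eqxx.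
Qed.

Lemma grid_count y : (x + r + y = 2 * p)%N ->
  (2 * p ^ 2 <= #|min_area_triangles grid| + (x ^ 2 + y ^ 2))%N.
Proof.
move=> e; apply: leq_trans (window_count e) _; rewrite leq_add2r.
pose A := [set t : 'I_p * 'I_p * 'I_r |
  (t.1.1 + t.1.2 == x + t.2)%N || ((t.1.1 + t.1.2).+1 == x + t.2)%N].
apply: (@leq_trans #|A|).
  have -> : #|A| = (\sum_(a < p) \sum_(b < p) \sum_(k < r)
      ((a + b == x + k) || ((a + b).+1 == x + k)))%N.
    rewrite pair_bigA pair_bigA -sum1_card big_mkcond /=.
    by apply: eq_bigr => t _; rewrite inE; case: (_ || _).
  apply: leq_sum => a _; apply: leq_sum => b _.
  apply: leq_trans (leq_add (window_sum _) (window_sum _)) _.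
  rewrite -big_split; apply: leq_sum => k _ /=.
  (* The two equations exclude each other, so the disjunction counts as their sum. *)
  case: eqP => [->|_]; last by case: eqP.
  by rewrite gtn_eqF.
pose f (t : 'I_p * 'I_p * 'I_r) := [set vline t.1.1; hline t.1.2; dline t.2]%SET.
have injf : injective f.
  move=> [[a b] k] [[a' b'] k'] /setP ef.
  have ap := ltn_ord a; have bp := ltn_ord b; have kr := ltn_ord k.
  have ap' := ltn_ord a'; have bp' := ltn_ord b'; have kr' := ltn_ord k'.
  have := ef (vline a); have := ef (hline b); have := ef (dline k).
  rewrite !inE !eqxx ?orbT -!val_eqE /= => /esym h3 /esym h2 /esym h1.
  have e1 : (a : nat) = a' by case/orP: h1 => [/orP[]|] /eqP; move: ap; lia.
  have e2 : (b : nat) = b' by case/orP: h2 => [/orP[]|] /eqP; move: ap' bp; lia.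
  have e3 : (k : nat) = k' by case/orP: h3 => [/orP[]|] /eqP; move: ap' bp' kr; lia.
  by rewrite (ord_inj e1) (ord_inj e2) (ord_inj e3).
rewrite -(card_imset _ injf); apply: subset_leq_card; apply/fintype.subsetP => _ /imsetP[t tA ->].
by apply: grid_min_triangle; rewrite inE in tA.
Qed.

End Construction.

(** For n = 6 l + e the classes get about 2 l lines each, and [x], [y] are close to l, so that the
    diagonals are nearly centred on the grid. *)
Lemma grid_parameters (n : nat) : (6 <= n)%N -> exists p r x y : nat,
  [/\ (p + p + r = n)%N, (x + r + y = 2 * p)%N
    & ((n ^ 2 - n) %/ 6 + (x ^ 2 + y ^ 2) <= 2 * p ^ 2)%N].
Proof.
move=> n6; have l1 : (1 <= n %/ 6)%N by rewrite divn_gt0.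
move: (divn_eq n 6) (ltn_pmod n (isT : (0 < 6)%N)) l1 => {n6}.
move: (n %/ 6)%N (n %% 6)%N => l e -> e6 l1 {n}.
(* [q] will be the quotient (n^2 - n) / 6, rounded down and written as a polynomial in [l]. *)
have fin p r x y q : (p + p + r = l * 6 + e)%N -> (x + r + y = 2 * p)%N ->
    ((l * 6 + e) ^ 2 - (l * 6 + e) < 6 * q.+1)%N -> (q + (x ^ 2 + y ^ 2) <= 2 * p ^ 2)%N ->
    exists p r x y : nat, [/\ (p + p + r = l * 6 + e)%N, (x + r + y = 2 * p)%N
    & (((l * 6 + e) ^ 2 - (l * 6 + e)) %/ 6 + (x ^ 2 + y ^ 2) <= 2 * p ^ 2)%N].
  move=> h1 h2 h3 h4; exists p, r, x, y; split=> //; apply: leq_trans h4.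
  by rewrite leq_add2r -ltnS ltn_divLR // (mulnC q.+1).
have [m lE] : exists m, l = m.+1 by exists l.-1; lia.
case: e e6 fin => [|[|[|[|[|[|e]]]]]] // _ fin.
- by apply: (fin (2 * l) (2 * l) l l (6 * l ^ 2 - l))%N; rewrite lE; nia.
- by apply: (fin (2 * l) (2 * l).+1 l.-1 l (6 * l ^ 2 + l))%N; rewrite lE; nia.
- by apply: (fin (2 * l).+1 (2 * l) l.+1 l.+1 (6 * l ^ 2 + 3 * l))%N; rewrite lE; nia.
- by apply: (fin (2 * l).+1 (2 * l).+1 l l.+1 (6 * l ^ 2 + 5 * l + 1))%N; rewrite lE; nia.
- by apply: (fin (2 * l).+1 (2 * l).+2 l l (6 * l ^ 2 + 7 * l + 2))%N; rewrite lE; nia.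
- by apply: (fin (2 * l).+2 (2 * l).+1 l.+1 l.+2 (6 * l ^ 2 + 9 * l + 3))%N; rewrite lE; nia.
Qed.

Theorem theorem2 (R : realType) (n : nat) (hn : (6 <= n)%N) :
  ((n ^ 2 - n) %/ 6 <= max_min_area_triangles R n)%N /\
  (max_min_area_triangles R n <= (n ^ 2 - 2 * n) %/ 3)%N.
Proof.
split; last first.
  apply/bigmax_leqP => S /asboolP[L [arrL ->]].
  by rewrite leq_divRL // -mulnn -mulnBl mulnC [leqRHS]mulnC upper_bound.
have [p [r [x [y [<- e2 e3]]]]] := grid_parameters hn.
apply: (@leq_trans #|min_area_triangles (@grid R p r x)|).
  by rewrite -(leq_add2r (x ^ 2 + y ^ 2)%N) (leq_trans e3) // grid_count.
apply: (@leq_bigmax_cond _ _ (fun S : {set {set 'I_(p + p + r)}} => #|S|)).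
by apply/asboolP; exists (@grid R p r x); split=> //; apply: grid_arrangement.
Qed.
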